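(* Let $\Gamma$ be a finite connected simple graph and let $G \leqslant \mathrm{Aut}(\Gamma)$ be arc-transitive. Suppose that for every vertex $v$ of $\Gamma$ the permutation group $G_v^{\Gamma(v)}$ is semiprimitive and has a regular normal nilpotent subgroup, and suppose that $G_{xy}^{[1]}\neq 1$ for some edge $\{x,y\}$ of $\Gamma$. Let $p$ be a prime dividing $|G_{xy}^{[1]}|$. Let $Q_x=\mathrm{O}_p(G_x^{[1]})$, $Q_y=\mathrm{O}_p(G_y^{[1]})$, and let $L_x=\langle (Q_xQ_y)^{g} \mid g\in G_x\rangle$, a normal subgroup of $G_x$. Put $V = \langle \Omega \mathrm{Z}(S) \mid S \in \mathrm{Syl}_p(L_x) \rangle$ and $H := \mathbf J(L_x)\, \mathrm{C}_{L_x}(V)/\mathrm{C}_{L_x}(V)$. Then the following hold, for suitable subgroups $E_1,\dots,E_r$ of $H$: (a) $G_{xy}^{[1]}$ is a $p$-group and $p\in \{2,3\}$. (b) $H = E_1 \times \cdots \times E_r$ and $$V = \mathrm{C}_{V}(H) \times [V,E_1] \times \cdots \times [V,E_r].$$ In particular, $E_i$ acts faithfully on $[V,E_i]$ and trivially on $[V,E_j]$ for $j\neq i$. (c) $|[V,E_i]| = p^2$ and $E_i \cong \mathrm{SL}_2(p)$ for $i=1,\dots,r$. (d) $A = (A\cap E_1)\times\cdots\times (A \cap E_r)$ and $|A||\mathrm{C}_{V}(A)| = |V|$ for all $A \in \mathcal A_{V}(H)$.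
   Context: For a vertex $v$ of $\Gamma$, $\Gamma(v)$ is the set of neighbours of $v$, $G_v$ is the stabiliser of $v$, $G_v^{\Gamma(v)}$ is the permutation group induced by $G_v$ on $\Gamma(v)$, and $G_v^{[1]}$ is the kernel of the action of $G_v$ on $\Gamma(v)$. For an edge $\{x,y\}$, $G_{xy}^{[1]}$ is the kernel of the action of the edge stabiliser $G_{\{x,y\}}$ on $\Gamma(x)\cup\Gamma(y)$, i.e. $G_{xy}^{[1]}=G_x^{[1]}\cap G_y^{[1]}$. $G$ is arc-transitive if it is transitive on ordered pairs of adjacent vertices. A subgroup $N$ of a permutation group on $\Omega$ is semiregular if $N_\omega=1$ for all $\omega\in\Omega$, and regular if it is transitive and semiregular. A permutation group is semiprimitive if it is transitive and every normal subgroup of it is transitive or semiregular. $\mathrm{O}_p(X)$ is the largest normal $p$-subgroup of $X$. For a $p$-group $P$, $\Omega\mathrm{Z}(P)$ is the subgroup of $\mathrm{Z}(P)$ generated by the elements of order $p$. For a $p$-group $S$, $\mathcal A(S)$ is the set of elementary abelian subgroups of maximal order in $S$, and $\mathbf J(S)=\langle A\mid A\in\mathcal A(S)\rangle$ is the Thompson subgroup. For a finite group $F$, $\mathbf J(F)=\langle \mathbf J(S)\mid S\in \mathrm{Syl}_p(F)\rangle$ (with respect to the prime $p$). The group $H$ acts (faithfully) on $V$ via conjugation, and $\mathrm{C}_V(\cdot)$, $[V,\cdot]$ refer to this action. $\mathcal A_V(H)$ is the set of elementary abelian $p$-subgroups $A\leqslant H$ such that $|A||\mathrm{C}_V(A)|\geqslant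 |B||\mathrm{C}_V(B)|$ for all subgroups $B\leqslant A$. All direct products are internal. *)

(* Defs.v *)
From HB Require Import structures.
From mathcomp Require Import all_boot all_order all_fingroup all_algebra all_solvable.

Set Implicit Arguments.
Unset Strict Implicit.
Unset Printing Implicit Defensive.

Local Open Scope group_scope.

(* A finite simple graph is a symmetric irreflexive [e : rel T], T : finType. *)
Section Graph.
Variables (T : finType) (e : rel T).

Definition nbhd (v : T) : {set T} := [set w | e v w].

Definition connected_graph : Prop := forall u v : T, connect e u v.

Definition graph_aut : {set {perm T}} :=
  [set g : {perm T} | [forall u, forall v, e (g u) (g v) == e u v]].

Definition arc_transitive (G : {set {perm T}}) : Prop :=
  forall u v u' v' : T, e u v -> e u' v' ->
  exists g : {perm T}, [/\ g \in G, g u = u' & g v = v'].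

Variable G : {group {perm T}}.

Definition vertex_stab (v : T) : {set {perm T}} := 'C_G[v | 'P].

(* Permutations of [nbhd v] are represented by their extensions to T fixing
   every point outside [nbhd v]. *)
Definition local_action (v : T) : {set {perm T}} :=
  restr_perm (nbhd v) @* vertex_stab v.

Definition vertex_kernel (v : T) : {set {perm T}} :=
  'C_(vertex_stab v)(nbhd v | 'P).

Definition edge_stab (x y : T) : {set {perm T}} := 'N_G([set x; y] | 'P).

Definition edge_kernel (x y : T) : {set {perm T}} :=
  'C_(edge_stab x y)(nbhd x :|: nbhd y | 'P).

Lemma edge_kernelE (x y : T) : symmetric e -> e x y ->
  edge_kernel x y = vertex_kernel x :&: vertex_kernel y.
Proof.
move=> sym_e exy; have eyx : e y x by rewrite sym_e.
apply/setP=> g; rewrite /edge_kernel /vertex_kernel /edge_stab /vertex_stab.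
apply/idP/idP.
  rewrite !inE => /andP[/andP[gG _] /subsetP fixg].
  have fixN z : e x z || e y z -> g z = z.
    by move=> ez; have:= fixg z; rewrite !inE => /(_ ez) /eqP.
  rewrite gG /=; apply/andP; split; apply/andP; split.
  - by apply/subsetP=> z; rewrite !inE => /eqP->; apply/eqP/fixN; rewrite eyx orbT.
  - by apply/subsetP=> z; rewrite !inE => ez; apply/eqP/fixN; rewrite ez.
  - by apply/subsetP=> z; rewrite !inE => /eqP->; apply/eqP/fixN; rewrite exy.
  - by apply/subsetP=> z; rewrite !inE => ez; apply/eqP/fixN; rewrite ez orbT.
rewrite !inE => /andP[/andP[/andP[gG _] /subsetP fx] /andP[_ /subsetP fy]].
have fixN z : e x z || e y z -> g z = z.
  by case/orP=> ez; [have:= fx z | have:= fy z]; rewrite !inE => /(_ ez) /eqP.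
rewrite gG /=; apply/andP; split; apply/subsetP=> z; rewrite !inE /aperm.
  by case/orP=> /eqP->; rewrite fixN ?exy ?eyx ?orbT // eqxx ?orbT.
by move=> ez; rewrite fixN.
Qed.

End Graph.

Section PermGroup.
Variable T : finType.
Implicit Types (P N : {set {perm T}}) (S : {set T}).

Definition semiregular_on N S : Prop :=
  forall w : T, w \in S -> 'C_N[w | 'P] = 1.

Definition regular_on N S : Prop :=
  [transitive N, on S | 'P] /\ semiregular_on N S.

Definition semiprimitive_on P S : Prop :=
  [transitive P, on S | 'P] /\
  forall N : {group {perm T}}, N <| P ->
    [transitive N, on S | 'P] \/ semiregular_on N S.

Definition has_regular_normal_nilpotent P S : Prop :=
  exists N : {group {perm T}}, [/\ N <| P, nilpotent N & regular_on N S].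

End PermGroup.

Section Thompson.
Variables (gT : finGroupType) (p : nat).
Implicit Types S F : {set gT}.

Definition max_abelem S : {set {group gT}} :=
  [set A in 'E_p(S) | [forall B in 'E_p(S), #|B| <= #|A|]].

Definition thompson_sub S : {group gT} :=
  <<(\bigcup_(A in max_abelem S) A)%g>>%G.

Definition thompson_Syl F : {group gT} :=
  <<(\bigcup_(S in 'Syl_p(F)) thompson_sub S)%g>>%G.

Definition omega_center_Syl F : {group gT} :=
  <<(\bigcup_(S in 'Syl_p(F)) 'Ohm_1('Z(S)))%g>>%G.

End Thompson.

Section Action.
Variables (aT gT : finGroupType) (D : {group aT}) (to : action D gT).
Implicit Types (V : {set gT}) (H A : {set aT}).

Definition act_commg V A : {group gT} :=
  <<([set v^-1 * to v a | v in V, a in A])%g>>%G.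

Definition best_offenders (p : nat) V H : {set {group aT}} :=
  [set A in 'E_p(H) | [forall B : {group aT}, (B \subset A) ==>
     (#|B| * #|'Fix_(V | to)(B)| <= #|A| * #|'Fix_(V | to)(A)|)%N]].

End Action.

Definition SL2 (p : nat) : {set {'GL_2[ 'F_p ]}} :=
  [set u | (\det (GLval u) == 1)%R].

Lemma SL2_group_set p : group_set (SL2 p).
Proof.
apply/group_setP; split=> [|u v]; first by rewrite inE GL_1E det1.
by rewrite !inE GL_ME det_mulmx => /eqP-> /eqP->; rewrite GRing.mulr1.
Qed.

Canonical SL2_group p := Group (SL2_group_set p).

Section Local.
Variables (T : finType) (e : rel T) (G : {group {perm T}}) (p : nat) (x y : T).

Definition Qv (v : T) : {set {perm T}} := 'O_p(vertex_kernel e G v).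

Definition Lx : {group {perm T}} :=
  <<(\bigcup_(g in vertex_stab G x) (Qv x * Qv y) :^ g)%g>>%G.

Definition Vx : {group {perm T}} := omega_center_Syl p Lx.

Lemma Vx_sub : Vx \subset Lx.
Proof.
rewrite gen_subG; apply/bigcupsP=> S; rewrite inE => /andP[sS _].
exact: subset_trans (Ohm_sub _ _) (subset_trans (center_sub _) sS).
Qed.
Lemma Vx_normal : Vx <| Lx.
Proof.
rewrite /normal Vx_sub /=; apply: norms_gen; apply/subsetP=> a La; rewrite inE.
apply/subsetP=> z /imsetP[w /bigcupP[S SylS wS] ->]; apply/bigcupP.
exists (S :^ a)%G; last first.
  rewrite /= (_ : 'Z(S :^ a) = 'Z(S) :^ a) ?OhmJ ?memJ_conjg //.
  by rewrite /center conjIg centJ.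
by move: SylS; rewrite !inE -{2}(conjGid La) pHallJ2.
Qed.

(* [thompson_Syl p Lx] and ['C_Lx(Vx)] are both normal in Lx, so that their
   product set is a group. *)
Definition Hx : {set coset_of 'C_Lx(Vx)} :=
  (thompson_Syl p Lx * 'C_Lx(Vx)) / 'C_Lx(Vx).

(* Conjugation on Vx, factored through 'C_Lx(Vx): a coset a 'C_Lx(Vx) acts by
   v |-> v ^ a on the points centralised by 'C_Lx(Vx), in particular on Vx. *)
Definition conjV : action (setT / 'C_Lx(Vx)) {perm T} := ('J %% 'C_Lx(Vx))%act.

Lemma conjVE a v : a \in Lx -> v \in Vx ->
  conjV v (coset 'C_Lx(Vx) a) = v ^ a.
Proof.
move=> La Vv; rewrite /conjV /= modactE //=; first exact: in_setT.
- have /andP[_ /subsetP] : 'C_Lx(Vx) <| Lx; last exact.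
  by apply: norm_normalI; exact: norms_cent (normal_norm Vx_normal).
- rewrite setTI; apply/afixP=> b /setIP[_ /centP cb].
  by rewrite /= conjgE -(cb v Vv) mulKg.
Qed.

End Local.

(* Main.v *)
Require Import Defs.
From HB Require Import structures.
From mathcomp Require Import all_boot all_order all_fingroup all_algebra all_solvable all_character.

Set Implicit Arguments.
Unset Strict Implicit.
Unset Printing Implicit Defensive.

Local Open Scope group_scope.

(* Semiprimitivity says that a normal subgroup of G_x whose intersection with
   G_y is not inside the kernel G_x^[1] is transitive on the neighbours of x; by
   connectedness a subgroup of G_xy normalised by such transitive subgroups of
   G_x and of G_y is trivial.  Applied to components and to r-cores, this shows
   that G_xy^[1] is a p-group; applied to ZJ-type subgroups of S = Q_x Q_y, which
   both G_x and an element swapping x and y would normalise, it shows that J(L_x)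
   does not centralise V.  The regular nilpotent subgroup is a p'-group, so that
   F = L_x / C(V) is a p-group modulo a soluble normal p'-subgroup N, with
   O_p(F) = 1, and H is generated by best offenders on V.  By coprime action and
   Thompson's A x B lemma a minimal best offender is generated by a transvection,
   and every best offender is generated by its transvection groups.
   The transvection groups inside N T, for T one of them, generate a copy of
   SL_2(p) acting on the plane they move, two such copies commute, and a
   p'-element of this copy acting as diag(2, 1/2) forces p <= 3. *)

(** * Coprime action *)

(** The transvection argument rests on one fact: for a transvection group T the Sylow p-subgroups of
    N T have order p. Two distinct transvection groups of N T therefore cannot act unipotently
    together, and counting in the plane that they move does the rest. The bound on p reflects that
    SL_2(p) has a normal p-complement only for p = 2 and p = 3. N is the image in F of the part of
    L_x that acts on the neighbours of x inside the regular nilpotent group. That part has Q_x as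
    its Sylow p-subgroup, so N is a p'-group because Q_x centralises V; this in turn holds because
    the centres of the Sylow p-subgroups of L_x lie in Q_x. The condition O_p(F) = 1 makes every
    p-subgroup of F act faithfully on N, so that statements about V can be obtained from coprime
    action. The geometry is developed for conjugation inside a single group, whereas H is a quotient
    acting on V from outside; a semidirect product links the two settings. *)

Section Coprime.
Variable gT : finGroupType.
Implicit Types (p q : nat) (A B G K M N R V : {group gT}).

Lemma coprime_cent_mul_comm A G : A \subset 'N(G) -> coprime #|G| #|A| ->
  solvable G -> 'C_G(A) * [~: G, A] = G.
Proof.
move=> nGA coGA solG; have sRG : [~: G, A] \subset G by rewrite commg_subl.
have nRG : G \subset 'N([~: G, A]) by apply: commg_norml.
have nRA : A \subset 'N([~: G, A]) by apply: commg_normr.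
rewrite normC; last by rewrite subIset ?nRG.
apply/eqP; rewrite eqEsubset mulG_subG subsetIl sRG /=.
rewrite -quotientSK //.
by rewrite coprime_quotient_cent // subsetI subxx /= quotient_cents2.
Qed.

Lemma coprime_commGid A G : A \subset 'N(G) -> coprime #|G| #|A| ->
  solvable G -> [~: G, A, A] = [~: G, A].
Proof.
move=> nGA coGA solG; have sRG : [~: G, A] \subset G by rewrite commg_subl.
have defG := coprime_cent_mul_comm nGA coGA solG.
apply/eqP; rewrite eqEsubset commSg //= gen_subG.
apply/subsetP=> _ /imset2P[g a Gg Aa ->].
have /mulsgP[c r /setIP[_ /centP cA] Rr ->] : g \in 'C_G(A) * [~: G, A].
  by rewrite defG.
by have /commgP/eqP ca := cA a Aa; rewrite commMgJ ca conj1g mul1g mem_commg.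
Qed.

Lemma coprime_comm1 A G : A \subset 'N(G) -> coprime #|G| #|A| ->
  solvable G -> [~: G, A, A] = 1 -> A \subset 'C(G).
Proof.
move=> nGA coGA solG; rewrite coprime_commGid // => R1.
by rewrite centsC; apply/commG1P.
Qed.

Lemma pgroup_cent_neq1 p R B : p.-group R -> p.-group B -> B \subset 'N(R) ->
  R :!=: 1 -> 'C_R(B) != 1.
Proof.
move=> pR pB nRB ntR; have pRB : p.-group (R <*> B).
  by rewrite /= norm_joinEr // pgroupM pR.
have nsR : R <| R <*> B by rewrite normalYl.
have := meet_center_nil (pgroup_nil pRB) nsR; rewrite ntR.
move/(_ isT); apply: contra => /eqP C1; rewrite -subG1 -C1 setIS //.
by rewrite subIset // centS ?orbT // joing_subr.
Qed.

Lemma pgroup_cent_prime p R B : prime p -> #|R| = p -> p.-group B ->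
  B \subset 'N(R) -> B \subset 'C(R).
Proof.
move=> p_pr oR pB nRB; rewrite centsC; apply/setIidPl/eqP.
have pR : p.-group R by rewrite /pgroup oR pnat_id.
have ntR : R :!=: 1 by rewrite -cardG_gt1 oR prime_gt1.
have := pgroup_cent_neq1 pR pB nRB ntR.
rewrite -cardG_gt1 => gt1; rewrite eqEcard subsetIl oR /=.
have := cardSg (subsetIl R 'C(B)); rewrite oR.
by case: (primeP p_pr) => _ dv /dv /orP[] /eqP oC; rewrite oC // in gt1 *.
Qed.

(* Thompson's A x B lemma. *)
Lemma coprime_cent_faithful p V B M : p.-group B -> p.-group V -> abelian V ->
  p^'.-group M -> B \subset 'N(V) -> M \subset 'N(V) -> B \subset 'C(M) ->
  M \subset 'C('C_V(B)) -> M \subset 'C(V).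
Proof.
move=> pB pV cVV p'M nVB nVM cBM cM.
have coVM : coprime #|V| #|M| := pnat_coprime pV p'M.
have pR : p.-group [~: V, M] by apply: pgroupS pV; rewrite commg_subl.
have nRB : B \subset 'N([~: V, M]) by rewrite normsR // cents_norm.
have tiR := coprime_abel_cent_TI nVM coVM cVV.
(* If [V, M] were nontrivial, B would fix a nontrivial point of it; M centralises that point,
   against the coprime fact that M has no nontrivial fixed point in [V, M]. *)
rewrite centsC; apply/commG1P/eqP; apply: contraT => ntR.
have := pgroup_cent_neq1 pR pB nRB ntR; rewrite -subG1 -tiR subsetI subsetIl.
rewrite (centsC _ M) (subset_trans cM) // centS // setSI //.
by rewrite commg_subl.
Qed.

(* For K minimal among the A-invariant subgroups of N not centralised by A, the
   hyperplane is 'C_A(K): a chief factor of K is an irreducible A-module with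
   kernel 'C_A(K), and an abelian group with a faithful irreducible module is
   cyclic. *)
Lemma abelem_hyperplane_nontriv p N A : prime p -> p.-abelem A ->
  p^'.-group N -> solvable N -> A \subset 'N(N) -> ~~ (A \subset 'C(N)) ->
  exists B : {group gT},
    [/\ B \subset A, #|A : B| = p & ~~ (A \subset 'C('C_N(B)))].
Proof.
move=> p_pr abA p'N solN nNA ncNA.
have [pA cAA] := (abelem_pgroup abA, abelem_abelian abA).
pose P (K : {group gT}) := (A \subset 'N(K)) && ~~ (A \subset 'C(K)).
have [K] : {K : {group gT} | mingroup K P & K \subset N}.
  by apply: mingroup_exists; rewrite /P nNA.
case/mingroupP=> /andP[nKA ncKA] minK sKN.
have ntK : K :!=: 1 by apply: contraNneq ncKA => ->; apply: cents1.
have solK := solvableS sKN solN.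
have p'K := pgroupS sKN p'N.
have coKA : coprime #|K| #|A| by rewrite coprime_sym; apply: pnat_coprime pA p'K.
pose L := (K <*> A)%G.
have nKL : L \subset 'N(K) by rewrite join_subG normG.
pose Q (M : {group gT}) := (M \proper K) && (L \subset 'N(M)).
have [M maxM] : {M : {group gT} | maxnormal M K L}.
  have [|M] := @maxgroup_exists _ Q 1%G; first by rewrite /Q proper1G ntK norms1.
  by exists M.
have /andP[prM nML] := maxgroupp maxM.
have minKM := maxnormal_minnormal (subset_trans (joing_subl K A) nML) nKL maxM.
have [nMK nMA] : K \subset 'N(M) /\ A \subset 'N(M).
  by move: nML; rewrite join_subG => /andP.
have sMK := proper_sub prM.
have cMA : A \subset 'C(M).
  apply: contraTT prM => ncM; rewrite properE sMK /= negbK.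
  by rewrite (minK M) // /P nMA.
have [nKLM ntKM abKM] := minnormal_solvable minKM (subxx _) (quotient_sol M solK).
have [q q_pr abKMq] := is_abelemP abKM.
pose Ab := (A / M)%G; pose Kb := (K / M)%G.
have nKbA : Ab \subset 'N(Kb) by apply: quotient_norms.
have minKA : minnormal Kb Ab.
  apply/mingroupP; split; first by rewrite ntKM nKbA.
  move=> H /andP[ntH nHA] sHK; have/mingroupP[_ ->] // := minKM.
  rewrite ntH /L quotientY // join_subG nHA andbT.
  by rewrite cents_norm // (subset_trans (abelem_abelian abKMq)) // centS.
have irrA : mx_irreducible (abelem_repr abKMq ntKM nKbA) by apply/abelem_mx_irrP.
have := center_kquo_cyclic irrA.
rewrite rker_abelem (_ : 'Z(_) = Ab / 'C_Ab(Kb)); last first.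
  by apply/center_idP; rewrite !quotient_abelian.
move=> cycA.

pose B := ('C_A(K))%G; have sBA : B \subset A by apply: subsetIl.
(* An element of A that is trivial on K / M is also trivial on M, hence on K by coprimality: the
   kernel on the chief factor comes from ['C_A(K)]. *)
have defB : 'C_Ab(Kb) = B / M.
  apply/eqP; rewrite eqEsubset subsetI quotientS ?subsetIl //=.
  rewrite quotient_cents ?subsetIr // andbT.
  apply/subsetP=> _ /setIP[/morphimP[a Na Aa ->] ca]; apply: mem_quotient.
  rewrite inE Aa /=; suffices : <[a]> \subset 'C(K) by rewrite cycle_subG.
  have sA : <[a]> \subset A by rewrite cycle_subG.
  apply: coprime_comm1 => //; first exact: subset_trans sA nKA.
    exact: coprimegS sA coKA.
  apply/commG1P; rewrite (subset_trans _ (_ : M \subset _)) //; last first.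
    by rewrite centsC (subset_trans sA).
  rewrite -quotient_cents2 ?(subset_trans sA nMA) //.
  by rewrite quotient_cycle // centsC cycle_subG.

have tiAM : A :&: M \subset B.
  by rewrite (coprime_TIg _) ?sub1G // coprime_sym (coprimeSg sMK).
have ntAB : ~~ (A \subset B) by apply: contra ncKA => /subsetIP[].
exists B; split=> //.
  have nBA : Ab \subset 'N(B / M).
    by rewrite cents_norm // centsC (subset_trans _ (quotient_abelian _ cAA)) ?quotientS.
  have oAB : #|Ab / (B / M)| = #|A : B| by rewrite card_quotient // index_quotient_eq.
  rewrite -oAB; rewrite defB in cycA; apply: (cyclic_abelem_prime _ cycA).
    by rewrite !quotient_abelem.
  by rewrite trivg_card1 oAB indexg_eq1.
apply: contra ncKA => cA; rewrite (subset_trans cA) // centS //.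
by rewrite subsetI sKN centsC subsetIr.
Qed.
End Coprime.

(** * Two-dimensional linear groups *)

Section Mx2.
Import GRing.Theory.
Variable F : fieldType.
Local Open Scope ring_scope.
Implicit Types a b c d : F.

Definition mx2 a b c d : 'M[F]_2 :=
  \matrix_(i, j) if i == 0 then if j == 0 then a else b
                 else if j == 0 then c else d.

Lemma mx2E (A : 'M[F]_2) : A = mx2 (A 0 0) (A 0 1) (A 1 0) (A 1 1).
Proof.
apply/matrixP=> i j; rewrite !mxE.
by case: i j => [[|[|//]] ?] [[|[|//]] ?] /=; congr (A _ _); apply: val_inj.
Qed.

Lemma mul_mx2 a b c d a' b' c' d' : mx2 a b c d *m mx2 a' b' c' d' =
  mx2 (a * a' + b * c') (a * b' + b * d') (c * a' + d * c') (c * b' + d * d').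
Proof.
apply/matrixP=> i j; rewrite !mxE !big_ord_recl big_ord0 !mxE /= addr0.
by case: i j => [[|[|//]] ?] [[|[|//]] ?].
Qed.

Lemma det_mx2 a b c d : \det (mx2 a b c d) = a * d - b * c.
Proof.
rewrite (expand_det_row _ 0) !big_ord_recl big_ord0 addr0 /cofactor !det_mx11 !mxE /=.
by rewrite !addn0 expr0 mul1r expr1 mulN1r mulrN.
Qed.

Lemma mx2_1 : 1%:M = mx2 1 0 0 1.
Proof. by rewrite [LHS]mx2E !mxE. Qed.

Lemma mx2_inj a b c d a' b' c' d' : mx2 a b c d = mx2 a' b' c' d' ->
  [/\ a = a', b = b', c = c' & d = d'].
Proof.
move/matrixP=> E; have [E0 E1] := (E 0, E 1).
by have := (E0 0, E0 1, E1 0, E1 1); rewrite !mxE /= => -[[[]]].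
Qed.

(** The outer factors undo the row and column operations that turn both diagonal entries into 1 by
    means of the invertible entry c; determinant 1 then kills the remaining entry. *)
Lemma mx2_elementary a b c d : c != 0 -> a * d - b * c = 1 ->
  mx2 a b c d = mx2 1 ((a - 1) / c) 0 1 *m mx2 1 0 c 1 *m mx2 1 ((d - 1) / c) 0 1.
Proof.
move=> c0 D; rewrite !mul_mx2 !(mulr0, mulr1, mul1r, mul0r, addr0, add0r).
have -> : 1 + (a - 1) / c * c = a by rewrite mulfVK // addrC subrK.
have -> : c * ((d - 1) / c) + 1 = d by rewrite mulrC mulfVK // subrK.
suff -> : a * ((d - 1) / c) + (a - 1) / c = b by [].
have -> : b = (a * d - 1) / c by rewrite -D opprB addrC subrK mulfK.
by rewrite mulrA -mulrDl mulrBr mulr1 addrA subrK.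
Qed.
End Mx2.

Section SL2gen.
Import GRing.Theory.
Variable p : nat.
Hypothesis p_pr : prime p.
Local Notation GL := {'GL_2['F_p]}.

Let GLval_inj : injective (@GLval 2 'F_p). Proof. exact: val_inj. Qed.

Lemma SL2_elementary_gen (D : {group GL}) :
  (forall c : 'F_p, exists2 u, u \in D & GLval u = mx2 1 0 c 1)%R ->
  (forall c : 'F_p, exists2 u, u \in D & GLval u = mx2 1 c 0 1)%R ->
  SL2 p \subset D.
Proof.
move=> lowD upD; apply/subsetP=> u; rewrite inE => /eqP.
have gen (v : GL) : (GLval v 1 0 != 0)%R -> (\det (GLval v) = 1)%R -> v \in D.
  rewrite [X in (\det X)%R]mx2E det_mx2 => nz dv.
  have [u1 D1 E1] := upD ((GLval v 0 0 - 1) / GLval v 1 0)%R.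
  have [u2 D2 E2] := lowD (GLval v 1 0)%R.
  have [u3 D3 E3] := upD ((GLval v 1 1 - 1) / GLval v 1 0)%R.
  suffices -> : v = u1 * u2 * u3 by rewrite !groupM.
  by apply: GLval_inj; rewrite !GL_MxE E1 E2 E3 [LHS]mx2E mx2_elementary.
move=> du; have [c0|] := eqVneq (GLval u 1 0)%R 0%R; last by move/gen; apply.
(* If the lower left entry of u is 0, the upper left one is nonzero, and l adds the first row to the
   second. *)
have [l Dl El] := lowD 1%R; rewrite -(mulKg l u) groupM ?groupV //.
apply: gen; last by rewrite GL_MxE det_mulmx du El det_mx2 !(mulr1, mul0r, subr0).
rewrite GL_MxE El {1}[GLval u]mx2E mul_mx2 mxE /= c0 mulr0 addr0 mul1r.
apply: contra_eq_neq du => a0.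
by rewrite [X in (\det X)%R]mx2E det_mx2 a0 c0 mulr0 mul0r subrr eq_sym oner_eq0.
Qed.

(** * Groups generated by two opposite unitriangular subgroups *)

Section Repr.
Variables (gT : finGroupType) (X T1 T2 : {group gT}).
Variable rG : mx_representation 'F_p X 2.
Hypotheses (injG : mx_faithful rG) (defX : X :=: T1 <*> T2).
Hypothesis lowT : forall t, t \in T1 -> exists c, (rG t = mx2 1 0 c 1)%R.
Hypothesis Tlow : forall c, exists2 t, t \in T1 & (rG t = mx2 1 0 c 1)%R.
Hypothesis upT : forall t, t \in T2 -> exists c, (rG t = mx2 1 c 0 1)%R.
Hypothesis Tup : forall c, exists2 t, t \in T2 & (rG t = mx2 1 c 0 1)%R.

Let sT1 : T1 \subset X. Proof. by rewrite defX joing_subl. Qed.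
Let sT2 : T2 \subset X. Proof. by rewrite defX joing_subr. Qed.

Lemma repr_SL2_isog : X \isog SL2 p.
Proof.
(* The default value 1 is never taken on X, where [rG x] is invertible. *)
pose f x : GL := insubd (1%g : GL) (rG x).
have fE x : x \in X -> GLval (f x) = rG x.
  by move=> Xx; rewrite [GLval _]val_insubd [_ \is a _](repr_mx_unit rG Xx).
have fM : {in X &, {morph f : x y / x * y}}.
  move=> x y Xx Xy; apply: GLval_inj.
  by rewrite GL_MxE !fE ?groupM // repr_mxM.
pose fm := Morphism fM.
have injf : 'injm fm.
  apply/subsetP=> x /morphpreP[Xx /set1P fx]; apply: (subsetP injG).
  by apply/rkerP; split; rewrite // -fE // [f x]fx.
rewrite -[SL2 p](_ : fm @* X = _) ?sub_isog //.
have imX : fm @* X = fm @* T1 <*> fm @* T2 by rewrite -morphimY // -defX.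
apply/eqP; rewrite eqEsubset; apply/andP; split.
  rewrite imX join_subG; apply/andP; split.
    apply/subsetP=> _ /morphimP[t Xt /lowT[c E] ->].
    by rewrite inE /= fE // E det_mx2 !(mulr1, mul0r, subr0).
  apply/subsetP=> _ /morphimP[t Xt /upT[c E] ->].
  by rewrite inE /= fE // E det_mx2 !(mulr1, mulr0, subr0).
apply: SL2_elementary_gen => c.
  have [t Tt E] := Tlow c; exists (f t); last by rewrite fE ?(subsetP sT1).
  by apply: (mem_morphim fm); apply: (subsetP sT1).
have [t Tt E] := Tup c; exists (f t); last by rewrite fE ?(subsetP sT2).
by apply: (mem_morphim fm); apply: (subsetP sT2).
Qed.

Lemma repr_inj : {in X &, injective rG}.
Proof.
move=> x y Xx Xy E; apply/eqP; rewrite eq_mulgV1.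
rewrite -in_set1; apply: (subsetP injG); apply/rkerP; split.
  by rewrite groupM ?groupV.
by rewrite repr_mxM ?groupV // E -repr_mxM ?groupV // mulgV repr_mx1.
Qed.

(* A p'-element of the normal p-complement D acting as diag(2, 1/2) normalises
   T1, hence centralises it, so that 4 = 1 in 'F_p. *)
Lemma repr_SL2_prime (D : {group gT}) : D <| X -> p^'.-group D ->
  p.-group (X / D) -> p.-group T1 -> p = 2 \/ p = 3.
Proof.
move=> nsDX p'D pXD pT1; have [->|p_neq2] := eqVneq p 2; [by left | right].
have p_odd : (2%:R != 0 :> 'F_p)%R.
  rewrite -(dvdn_pcharf (pchar_Fp p_pr)); apply: contra p_neq2.
  by move/(dvdn_leq (isT : 0 < 2)) => le2; rewrite eqn_leq le2 prime_gt1.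
have nDX := normal_norm nsDX.
have [x Xx rx] : exists2 x, x \in X & (rG x = mx2 2%:R 0 0 2%:R^-1)%R.
  (* The product of t2, t3, t4 is the elementary factorisation of [mx2 2 0 2 (1/2)]; t1 subtracts
     the first row from the second and leaves diag(2, 1/2). *)
  have [t1 Tt1 E1] := Tlow (-1)%R.
  have [t2 Tt2 E2] := Tup ((2%:R - 1) / 2%:R)%R.
  have [t3 Tt3 E3] := Tlow 2%:R%R.
  have [t4 Tt4 E4] := Tup ((2%:R^-1 - 1) / 2%:R)%R.
  have [[X1 X3] [X2 X4]] := ((subsetP sT1 _ Tt1, subsetP sT1 _ Tt3),
                             (subsetP sT2 _ Tt2, subsetP sT2 _ Tt4)).
  exists (t1 * (t2 * t3 * t4)); first by rewrite !groupM.
  rewrite !repr_mxM ?groupM // E1 E2 E3 E4.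
  rewrite -(@mx2_elementary _ 2%:R 0 2%:R 2%:R^-1)%R //; last first.
    by rewrite mulfV // mul0r subr0.
  rewrite mul_mx2 !(mulr0, mul0r, mulr1, mul1r, addr0, add0r).
  by rewrite mulN1r addNr.
have Dx : x \in D.
  (* Frobenius fixes the diagonal entries, which lie in the prime field. As x = x^(p^k) for all k,
     the image of x in the p-group X / D is trivial. *)
  have xp : x ^+ p = x.
    apply: repr_inj; rewrite ?groupX // repr_mxX // rx.
    have mx2X a b k : (mx2 a 0 0 b ^+ k = mx2 (a ^+ k) 0 0 (b ^+ k) :> 'M['F_p]_2)%R.
      elim: k => [|k IH]; first by rewrite !expr0 -mx2_1.
      by rewrite !exprS IH [LHS]mul_mx2 !(mulr0, mul0r, addr0, add0r).
    have Fp_exp (a : 'F_p) : (a ^+ p = a)%R.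
      by rewrite -[a]natr_Zp -(pFrobenius_autE (pchar_Fp p_pr)) pFrobenius_aut_nat.
    by rewrite mx2X !Fp_exp.
  have Nx := subsetP nDX x Xx; rewrite coset_idr //.
  have [k ok] := p_natP (mem_p_elt pXD (mem_quotient D Xx)).
  have xk : x ^+ (p ^ k) = x by elim: (k) => // j IH; rewrite expnSr expgM IH.
  by rewrite -xk morphX // -ok expg_order.
(* Conjugation by diag(2, 1/2) multiplies the lower left entry by 4, whence t'; the equality t = t'
   then makes p divide 3. *)
have [t Tt rt] := Tlow 1%R; have [t' Tt' rt'] := Tlow 4%:R%R.
have Xt := subsetP sT1 t Tt; have Xt' := subsetP sT1 t' Tt'.
have Etx : t ^ x = t'.
  apply: (mulgI x); rewrite -conjgC; apply: repr_inj; rewrite ?groupM //.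
  rewrite !repr_mxM // rx rt rt' !mul_mx2 !(mulr0, mul0r, mulr1, mul1r, addr0, add0r).
  congr mx2; apply: (mulfI p_odd).
  by rewrite mulVKf // -natrM.
have : t^-1 * t' \in D :&: T1.
  apply/setIP; split; last by rewrite groupM ?groupV.
  rewrite -Etx -commgEl commgEr groupM //.
  by rewrite memJ_norm ?groupV // (subsetP nDX).
rewrite coprime_TIg; last by rewrite coprime_sym (pnat_coprime pT1).
move/set1P/eqP; rewrite -eq_mulVg1 => /eqP Ett.
move: rt'; rewrite -Ett rt => /mx2_inj[_ _ /eqP].
rewrite -subr_eq0 -opprB oppr_eq0 -(natrB _ (_ : 1 <= 4)%N) //.
by rewrite -(dvdn_pcharf (pchar_Fp p_pr)) dvdn_prime2 // => /eqP.
Qed.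

End Repr.

(** Change of basis to v1, v2. Matrices act on row vectors, so the group fixing v1 becomes lower
    triangular. The dimension stays a variable equal to 2 because that of [abelem_repr] is 2 only
    provably. *)
Lemma repr_basis2 (gT : finGroupType) (X T1 T2 : {group gT}) n
    (rG : mx_representation 'F_p X n) (v1 v2 : 'rV['F_p]_n) :
    n = 2 -> mx_faithful rG -> T1 \subset X -> T2 \subset X ->
    v1 != 0%R -> (forall c, v2 <> c *: v1)%R ->
    (forall t, t \in T1 -> v1 *m rG t = v1 /\ exists c, v2 *m rG t = v2 + c *: v1)%R ->
    (forall c, exists2 t, t \in T1 & v2 *m rG t = v2 + c *: v1)%R ->
    (forall t, t \in T2 -> v2 *m rG t = v2 /\ exists c, v1 *m rG t = v1 + c *: v2)%R ->
    (forall c, exists2 t, t \in T2 & v1 *m rG t = v1 + c *: v2)%R ->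
  exists rB : mx_representation 'F_p X 2,
  [/\ mx_faithful rB,
      forall t, t \in T1 -> exists c, (rB t = mx2 1 0 c 1)%R,
      forall c, exists2 t, t \in T1 & (rB t = mx2 1 0 c 1)%R,
      forall t, t \in T2 -> exists c, (rB t = mx2 1 c 0 1)%R &
      forall c, exists2 t, t \in T2 & (rB t = mx2 1 c 0 1)%R].
Proof.
move=> n2; subst n => injG sT1 sT2 nz1 ind lowT Tlow upT Tup.
pose B : 'M['F_p]_2 := (\matrix_(i, j) if i == 0 then v1 0 j else v2 0 j)%R.
have mulB a b c d : (mx2 a b c d *m B =
   \matrix_(i, j) if i == 0 then a * v1 0 j + b * v2 0 j
                            else c * v1 0 j + d * v2 0 j)%R.
  apply/matrixP=> i j; rewrite !mxE !big_ord_recl big_ord0 !mxE /= addr0.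
  by case: ifP.
have Bmul A : (B *m A = \matrix_(i, j) if i == 0 then (v1 *m A) 0 j else (v2 *m A) 0 j)%R.
  by apply/matrixP=> i j; rewrite !mxE; case: ifP => Ei; apply: eq_bigr => k _; rewrite !mxE Ei.
have uB : B \in unitmx.
  rewrite -row_free_unit -kermx_eq0; apply/rowV0P=> w /sub_kermxP wB.
  have wE : (w 0 0 *: v1 + w 0 1 *: v2 = 0)%R.
    rewrite -wB; apply/rowP=> j; rewrite !mxE !big_ord_recl big_ord0 !mxE /= addr0.
    by congr (_ * _ + w _ _ * _)%R; apply: val_inj.
  have w1 : (w 0 1 = 0)%R.
    apply/eqP; apply: contraT => nz; case: (ind (- (w 0 0 / w 0 1))%R).
    apply: (scalerI nz); rewrite scalerA mulrN mulrC divfK // scaleNr.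
    by apply/eqP; rewrite -addr_eq0 addrC wE.
  move/eqP: wE; rewrite w1 scale0r addr0 scaler_eq0 (negPf nz1) orbF => /eqP w0.
  apply/rowP=> -[[|[|//]] lt]; rewrite mxE.
    by rewrite -[RHS]w0; congr (w _ _); apply: val_inj.
  by rewrite -[RHS]w1; congr (w _ _); apply: val_inj.
exists (rconj_repr rG uB).
have rE t a b c d : (B *m rG t = mx2 a b c d *m B -> rconj_repr rG uB t = mx2 a b c d)%R.
  by rewrite rconj_mxE => ->; rewrite mulmxK.
have low t c : (v1 *m rG t = v1 -> v2 *m rG t = v2 + c *: v1 ->
    rconj_repr rG uB t = mx2 1 0 c 1)%R.
  move=> e1 e2; apply: rE; rewrite mulB Bmul e1 e2; apply/matrixP=> i j.
  by rewrite !mxE; case: ifP; rewrite mul1r ?mul0r ?addr0 // addrC.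
have up t c : (v2 *m rG t = v2 -> v1 *m rG t = v1 + c *: v2 ->
    rconj_repr rG uB t = mx2 1 c 0 1)%R.
  move=> e1 e2; apply: rE; rewrite mulB Bmul e1 e2; apply/matrixP=> i j.
  by rewrite !mxE; case: ifP; rewrite mul1r ?mul0r ?add0r.
split.
- apply/subsetP=> x /rkerP[Xx rx]; apply: (subsetP injG); apply/rkerP; split=> //.
  have := rconj_mxE rG uB x; rewrite rx => /(congr1 (fun A => invmx B *m A *m B)%R).
  by rewrite mulmx1 mulVmx // !mulmxA mulVmx // mul1mx mulmxKV.
- by move=> t /lowT[e1 [c e2]]; exists c; apply: low.
- move=> c; have [t Tt e2] := Tlow c; exists t => //; apply: low => //.
  by have [] := lowT t Tt.
- by move=> t /upT[e1 [c e2]]; exists c; apply: up.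
move=> c; have [t Tt e2] := Tup c; exists t => //; apply: up => //.
by have [] := upT t Tt.
Qed.

End SL2gen.

(** * Transvections and best offenders *)

Lemma commg_joing_sub (gT : finGroupType) (A B C D : {group gT}) :
  A \subset 'N(D) -> B \subset 'N(D) -> C \subset 'N(D) ->
  [~: A, B] \subset D -> [~: A, C] \subset D -> [~: A, B <*> C] \subset D.
Proof.
move=> nDA nDB nDC sAB sAC; rewrite -quotient_cents2 ?join_subG ?nDB //.
by rewrite quotientY // centsC join_subG -!(centsC (A / D)) !quotient_cents2 ?sAB.
Qed.

Lemma commg_gen_sub (gT : finGroupType) (A B : {set gT}) (D : {group gT}) :
  A \subset 'N(D) -> B \subset 'N(D) -> [~: A, B] \subset D ->
  [~: A, <<B>>] \subset D.
Proof.
move=> nDA nDB sAB; rewrite -quotient_cents2 ?gen_subG // quotient_gen //.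
by rewrite cent_gen quotient_cents2.
Qed.

Lemma bigdprod_gen (gT : finGroupType) (I : finType) (F : I -> {group gT})
    (G : {group gT}) :
  (forall i j, i != j -> F i \subset 'C(F j)) ->
  (forall i, F i :&: <<\bigcup_(j | j != i) F j>> = 1) ->
  <<\bigcup_i F i>> = G -> \big[dprod/1]_i F i = G.
Proof.
move=> cFF tiF defG; rewrite -defG -bigprodGE; apply/eqP/bigdprodYP=> i _.
rewrite bigprodGE subsetD; apply/andP; split.
  by rewrite gen_subG; apply/bigcupsP=> j; apply: cFF.
by rewrite -setI_eq0 setIDA setIC tiF setDv.
Qed.

Section Transvections.
Variables (gT : finGroupType) (p : nat) (V F N : {group gT}).
Hypotheses (p_pr : prime p) (abV : p.-abelem V) (nVF : F \subset 'N(V)).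
Hypotheses (cFV : 'C_F(V) = 1) (nsNF : N <| F) (p'N : p^'.-group N).
Hypothesis solN : solvable N.
Hypothesis cNp : forall A : {group gT}, A \subset F -> p.-group A -> 'C_A(N) = 1.
Implicit Types (A B D L R S T X : {group gT}).

Let pV : p.-group V := abelem_pgroup abV.
Let cVV : abelian V := abelem_abelian abV.
Let nNF : F \subset 'N(N) := normal_norm nsNF.
Let sNF : N \subset F := normal_sub nsNF.
Let nVN : N \subset 'N(V) := subset_trans sNF nVF.

(** A group generated by one transvection. Over the prime field this is a whole root group: its
    centre line and its axis determine it, by [transv_eq]. *)
Definition transv T := [&& T \subset F, #|T| == p & #|V : 'C_V(T)| == p].

Lemma transvP T : transv T -> [/\ T \subset F, #|T| = p & #|V : 'C_V(T)| = p].
Proof. by case/and3P=> ? /eqP ? /eqP ?. Qed.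

Lemma transv_norm T : transv T -> T \subset 'N(V).
Proof. by case/transvP=> sTF _ _; apply: subset_trans nVF. Qed.

Lemma transv_pgroup T : transv T -> p.-group T.
Proof. by case/transvP=> _ oT _; rewrite /pgroup oT pnat_id. Qed.

Lemma comm_transv_sub T : transv T -> [~: V, T] \subset V.
Proof. by move=> tT; rewrite commg_subl transv_norm. Qed.

(** For a generator a of T, the map v |-> [v, a] is an endomorphism of the abelian group V with
    kernel ['C_V(T)] and image [V, T]. *)
Lemma card_comm_transv T : transv T -> #|[~: V, T]| = p.
Proof.
move=> tT; have nVT := transv_norm tT; have [sTF oT iT] := transvP tT.
have /cyclicP[a defT] : cyclic T by rewrite prime_cyclic ?oT.
have Na : a \in 'N(V) by rewrite -cycle_subG -defT.
have Vc v : v \in V -> [~ v, a] \in V.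
  by move=> Vv; rewrite commgEl groupM ?groupV // memJ_norm.
have fM : {in V &, {morph (fun v => [~ v, a]) : u v / u * v}}.
  move=> u v Vu Vv /=; rewrite commMgJ; congr (_ * _).
  by rewrite conjgE (centsP cVV _ (Vc u Vu) v Vv) mulKg.
pose f := Morphism fM.
have sfV : f @* V \subset V.
  by apply/subsetP=> _ /morphimP[v _ Vv ->]; apply: Vc.
suffices -> : [~: V, T] = f @* V.
  rewrite card_morphim setIid (_ : 'ker f = 'C_V(T)) //.
  apply/setP=> v; rewrite !inE /= defT cent_cycle; apply: andb_id2l => Vv.
  by rewrite cent1C; apply/commgP/cent1P.
apply/eqP; rewrite eqEsubset gen_subG; apply/andP; split; last first.
  apply/subsetP=> _ /morphimP[v _ Vv ->]; rewrite mem_commg // defT cycle_id //.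
apply/subsetP=> _ /imset2P[v t Vv Tt ->].
move: Tt; rewrite defT => /cycleP[k ->].
elim: k => [|k IH]; first by rewrite expg0 commg1 group1.
rewrite expgSr commgMJ groupM //; first by apply/morphimP; exists v.
have Vk := subsetP sfV _ IH; set x := [~ v, a ^+ k] in IH Vk *.
have -> : x ^ a = x * [~ x, a] by rewrite conjg_mulR.
by rewrite groupM //; apply/morphimP; exists x.
Qed.

Lemma transv_cent_comm T : transv T -> T \subset 'C([~: V, T]).
Proof.
move=> tT; apply: (pgroup_cent_prime p_pr (card_comm_transv tT)).
  exact: transv_pgroup.
exact: commg_normr.
Qed.

(** No nontrivial element of T fixes u, so a |-> [u, a] is injective between two sets of size p.
    This lets T imitate on u any element that moves u along [V, T]. *)
Lemma comm_transv_image T u : transv T -> u \in V -> ~~ (T \subset 'C[u]) ->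
  [set [~ u, a] | a in T] = [~: V, T].
Proof.
move=> tT Vu ncu; have [sTF oT iT] := transvP tT.
apply/eqP; rewrite eqEcard card_comm_transv //; apply/andP; split.
  by apply/subsetP=> _ /imsetP[a Ta ->]; apply: mem_commg.
have tiT : T :&: 'C[u] = 1 by rewrite prime_TIg ?oT.
rewrite card_in_imset ?oT // => a b Ta Tb /= /mulgI/(congr1 (conjg^~ b^-1)).
rewrite -!conjgM mulgV conjg1 => /conjg_fixP cab.
apply/eqP; rewrite eq_mulgV1 -in_set1 -[set1 1]tiT inE groupM ?groupV //=.
by rewrite cent1C; apply/cent1P/commgP.
Qed.

Lemma transv_span T u : transv T -> u \in V -> ~~ (T \subset 'C[u]) ->
  'C_V(T) * <[u]> = V.
Proof.
move=> tT Vu ncu; have [sTF oT iT] := transvP tT.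
have maxC : maximal 'C_V(T) V by apply: p_index_maximal; rewrite ?subsetIl ?iT.
apply: (mulg_normal_maximal _ maxC); rewrite ?cycle_subG //.
  by rewrite -sub_abelian_normal ?subsetIl.
by rewrite inE Vu /= -sub_cent1.
Qed.

Lemma transv_move T : transv T -> exists2 u, u \in V & ~~ (T \subset 'C[u]).
Proof.
move=> tT; have [sTF oT iT] := transvP tT.
have : ~~ (V \subset 'C(T)).
  by apply/negP=> /setIidPl E; move: p_pr; rewrite -iT E indexgg.
by case/subsetPn=> u Vu ncu; exists u; rewrite // sub_cent1.
Qed.

(** For b in T2, some a in T1 moves a vector u outside the common hyperplane as b does; then b a^-1
    fixes u and the hyperplane, hence V, and F is faithful. *)
Lemma transv_eq T1 T2 : transv T1 -> transv T2 ->
  [~: V, T1] = [~: V, T2] -> 'C_V(T1) = 'C_V(T2) -> T1 :=: T2.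
Proof.
move=> tT1 tT2 eql eqC; have [sT1 oT1 _] := transvP tT1.
have [sT2 oT2 _] := transvP tT2.
apply/eqP; rewrite eq_sym eqEcard oT1 oT2 leqnn andbT.
have [u Vu ncu] := transv_move tT1.
apply/subsetP=> b Tb.
have : [~ u, b] \in [~: V, T1] by rewrite eql mem_commg.
rewrite -(comm_transv_image tT1 Vu ncu) => /imsetP[a Ta /mulgI Eab].
have Fab : b * a^-1 \in F.
  by rewrite groupM ?groupV //; [apply: (subsetP sT2) | apply: (subsetP sT1)].
suffices : b * a^-1 \in 'C_F(V) by rewrite cFV inE -eq_mulgV1 => /eqP->.
rewrite inE Fab -sub_cent1 -(transv_span tT1 Vu ncu) mul_subG //.
  apply/subsetP=> v /[dup]; rewrite {1}eqC => /setIP[_ /centP cv2] /setIP[_ /centP cv1].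
  by apply/cent1P/commuteM; [apply: cv2 | apply/commuteV; apply: cv1].
rewrite cycle_subG; apply/cent1P/commgP/conjg_fixP.
by rewrite conjgM Eab -conjgM mulgV conjg1.
Qed.

Lemma transvJ T x : x \in F -> transv T -> transv (T :^ x).
Proof.
move=> Fx /transvP[sTF oT iT]; rewrite /transv cardJg oT eqxx -{1}(conjGid Fx).
have -> : 'C_V((T :^ x)%G) = 'C_V(T) :^ x.
  by rewrite /= centJ conjIg (normsP nVF x Fx).
have iJ : #|V : 'C_V(T) :^ x| = p.
  rewrite -divgS; last by rewrite -(normsP nVF x Fx) conjSg subsetIl.
  by rewrite cardJg divgS ?subsetIl.
by rewrite conjSg sTF iJ eqxx.
Qed.

Lemma comm_transvJ T x : x \in F -> [~: V, T :^ x] = [~: V, T] :^ x.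
Proof. by move=> Fx; rewrite conjsRg (normsP nVF). Qed.

Lemma card_joing_transv T : transv T -> #|N <*> T| = (#|N| * p)%N.
Proof.
move=> tT; have [sTF oT _] := transvP tT.
rewrite norm_joinEr ?(subset_trans sTF) // TI_cardMg ?oT //.
by rewrite coprime_TIg // coprime_sym (pnat_coprime (transv_pgroup tT)).
Qed.

Lemma joing_transv_eq T1 T2 : transv T1 -> transv T2 -> T2 \subset N <*> T1 ->
  N <*> T2 = N <*> T1.
Proof.
move=> tT1 tT2 sT2; apply/eqP; rewrite eqEcard join_subG joing_subl sT2 /=.
by rewrite !card_joing_transv.
Qed.

(* Otherwise T1 <*> T2 stabilises a chain of V with trivial action on the
   factors, so it meets the p'-group N trivially and T1 = T2. *)
Lemma transv_comm_move T1 T2 : transv T1 -> transv T2 -> T2 \subset N <*> T1 ->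
  T1 :!=: T2 -> ~~ ([~: V, T2] \subset 'C(T1)).
Proof.
move=> tT1 tT2 sT2; apply: contra => c21.
have [[sT1F oT1 _] [sT2F oT2 _]] := (transvP tT1, transvP tT2).
pose X := (T1 <*> T2)%G; pose M := (N :&: X)%G.
pose U := ([~: V, T1] <*> [~: V, T2])%G.
have sXF : X \subset F by rewrite join_subG sT1F.
have nVX := subset_trans sXF nVF.
have sUV : U \subset V by rewrite join_subG !comm_transv_sub.
have cT1U : T1 \subset 'C(U).
  by rewrite centsC join_subG c21 centsC transv_cent_comm.
have c12 : T1 \subset 'C([~: V, T2]) by rewrite centsC.
have nlT1 : T1 \subset 'N([~: V, T2]) := cents_norm c12.
have nlT2 : T2 \subset 'N([~: V, T2]) by apply: commg_normr.
have nUT1 : T1 \subset 'N(U) := cents_norm cT1U.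
have nUT2 : T2 \subset 'N(U).
  by rewrite -commg_subl (subset_trans (commSg _ sUV)) ?joing_subr.
have nUV : V \subset 'N(U) by rewrite sub_abelian_norm.
have nlU : U \subset 'N([~: V, T2]).
  by rewrite (sub_abelian_norm (abelianS sUV cVV)) ?joing_subr.
(* The chain is V, U, [V, T2], 1: commutation with X takes each term into the next. *)
have h1 : [~: V, X] \subset U.
  by rewrite commg_joing_sub ?joing_subl ?joing_subr.
have h2 : [~: U, X] \subset [~: V, T2].
  rewrite (@commg_joing_sub _ U T1 T2 [~: V, T2]) ?commSg //.
  by rewrite (commG1P _) ?sub1G // centsC.
have h3 : [~: [~: V, T2], X] = 1.
  apply/commG1P.
  by rewrite centsC join_subG c12 transv_cent_comm.
have sMX : M \subset X := subsetIr _ _.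
have p'M : p^'.-group M := pgroupS (subsetIl _ _) p'N.
have coVM : coprime #|V| #|M| := pnat_coprime pV p'M.
have nVM := subset_trans sMX nVX.
(* By coprimality [V, M] is unchanged by commutation with M, so it slides down the chain to 1. *)
have RR : [~: V, M, M] = [~: V, M].
  by rewrite coprime_commGid // abelian_sol.
have R1 : [~: V, M] \subset U := subset_trans (commgS _ sMX) h1.
have R2 : [~: V, M] \subset [~: V, T2].
  by rewrite -RR (subset_trans (commgSS R1 sMX)).
have R3 : [~: V, M] = 1.
  by rewrite -RR; apply/trivgP; rewrite -h3 commgSS.
have M1 : M :=: 1.
  apply/trivgP; rewrite -cFV subsetI (subset_trans sMX) //= centsC.
  exact/commG1P.
(* Since X meets N trivially and lies in N T1, its order is at most |N T1 : N| = p. *)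
have leX : #|X| <= p.
  rewrite -(leq_pmul2l (cardG_gt0 N)) -TI_cardMg // -(card_joing_transv tT1).
  by rewrite subset_leq_card // mul_subG ?joing_subl // join_subG joing_subr.
have eqX T : T \subset X -> #|T| = p -> T :=: X.
  by move=> sTX oT; apply/eqP; rewrite eqEcard sTX oT.
by rewrite (eqX T1) ?joing_subl // -(eqX T2) ?joing_subr.
Qed.

(** * The plane moved by two transvection groups with the same product with N *)

Section Pair.
Variables T1 T2 : {group gT}.
Hypotheses (tT1 : transv T1) (tT2 : transv T2) (sT2 : T2 \subset N <*> T1).
Hypothesis neT : T1 :!=: T2.
Let X := (T1 <*> T2)%G.
Let U := ([~: V, T1] <*> [~: V, T2])%G.

Let sT1 : T1 \subset N <*> T2.
Proof. by rewrite (joing_transv_eq tT1 tT2 sT2) joing_subr. Qed.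

Let sUV : U \subset V.
Proof. by rewrite join_subG !comm_transv_sub. Qed.

Let tiC T T' : transv T -> ~~ ([~: V, T] \subset 'C(T')) ->
  [~: V, T] :&: 'C(T') = 1.
Proof. by move=> tT; apply: prime_TIg; rewrite card_comm_transv. Qed.

Let ti12 : [~: V, T1] :&: 'C(T2) = 1.
Proof. by rewrite tiC // transv_comm_move // eq_sym. Qed.

Let ti21 : [~: V, T2] :&: 'C(T1) = 1.
Proof. by rewrite tiC // transv_comm_move. Qed.

Let defU : U = [~: V, T1] * [~: V, T2] :> {set gT}.
Proof.
rewrite /= cent_joinEr // (subset_trans (comm_transv_sub tT2)) //.
by rewrite (subset_trans cVV) // centS // comm_transv_sub.
Qed.

Lemma card_transv_pair : #|U| = (p ^ 2)%N.
Proof.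
rewrite defU TI_cardMg ?card_comm_transv // -?mulnn //.
by apply/trivgP; rewrite -ti12 setIS // centsC transv_cent_comm.
Qed.

(** Two hyperplanes meet in a subgroup of index at most p^2 = |U|, so it is enough that U meets this
    intersection trivially. *)
Lemma transv_pair_dprod : U \x 'C_V(X) = V.
Proof.
have tiU : U :&: 'C_V(X) = 1.
  apply/trivgP; rewrite -ti12 subsetI; apply/andP; split; last first.
    by rewrite !(subset_trans (subsetIr _ _)) // centS // joing_subr.
  rewrite -(mulg1 [~: V, T1]) -ti21 group_modl; last first.
    by rewrite centsC transv_cent_comm.
  by rewrite -defU setIS // (subset_trans (subsetIr _ _)) // centS // joing_subl.
rewrite dprodE //; last first.
  by rewrite (subset_trans (subsetIl _ _)) // (subset_trans cVV) // centS.
apply/eqP; rewrite eqEcard mulG_subG sUV subsetIl TI_cardMg // card_transv_pair /=.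
have [[_ _ i1] [_ _ i2]] := (transvP tT1, transvP tT2).
have defC : 'C_V(X) = 'C_V(T1) :&: 'C_V(T2).
  by rewrite -setIIr -centY.
rewrite defC -(leq_pmul2l (cardG_gt0 V)) mulnA (mulnC #|V|) -mulnA.
have sC T : 'C_V(T) \subset V := subsetIl _ _.
have oC T : #|V : 'C_V(T)| = p -> #|V| = (p * #|'C_V(T)|)%N.
  by move=> iT; rewrite -(Lagrange (sC T)) iT mulnC.
have -> : (#|V| * #|V| = p ^ 2 * (#|'C_V(T1)| * #|'C_V(T2)|))%N.
  by rewrite {1}(oC _ i1) (oC _ i2) mulnACA mulnn.
rewrite mul_cardG mulnCA leq_mul // subset_leq_card //.
by rewrite mul_subG ?sC.
Qed.

Lemma comm_transv_pair : [~: V, X] = U.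
Proof.
have nU A : A \subset V -> A \subset 'N(U).
  by move=> sA; rewrite cents_norm // (subset_trans sA) // (subset_trans cVV) ?centS.
have nT T : transv T -> [~: V, T] \subset U -> T \subset 'N(U).
  by move=> tT sT; rewrite -commg_subl (subset_trans (commSg _ sUV)).
have nUV := nU V (subxx _).
have nUT1 := nT T1 tT1 (joing_subl _ _).
have nUT2 := nT T2 tT2 (joing_subr _ _).
apply/eqP; rewrite eqEsubset commg_joing_sub ?joing_subl ?joing_subr //=.
by rewrite join_subG !commgS ?joing_subl ?joing_subr.
Qed.

(** T1 fixes its own line and permutes the other p lines of U transitively: a generator z u, with z
    in [V, T1] and u in [V, T2] not fixed by T1, equals u [u, a] = u^a for some a in T1. *)
Lemma transv_pair_line L : L \subset U -> #|L| = p ->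
  L :=: [~: V, T1] \/ exists2 a, a \in T1 & L :=: [~: V, T2 :^ a].
Proof.
move=> sLU oL; have [[sF1 oT1 _] [sF2 oT2 _]] := (transvP tT1, transvP tT2).
have /cyclicP[w defL] : cyclic L by rewrite prime_cyclic ?oL.
have : w \in U by rewrite -cycle_subG -defL.
rewrite -[_ \in _]/(w \in gval U) defU => /mulsgP[z u z1 u2 defw].
have [[Vz Vu]] : z \in V /\ u \in V.
  by rewrite (subsetP (comm_transv_sub tT1)) // (subsetP (comm_transv_sub tT2)).
have [cu|ncu] := boolP (u \in 'C(T1)).
  have u1 : u = 1 by apply/set1P; rewrite -[[set 1]]ti21 inE u2.
  left; apply/eqP; rewrite eqEcard oL card_comm_transv // leqnn andbT.
  by rewrite defL cycle_subG defw u1 mulg1.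
right; have ncu1 : ~~ (T1 \subset 'C[u]) by rewrite sub_cent1.
move: z1; rewrite -(comm_transv_image tT1 Vu ncu1) => /imsetP[a Ta defz].
have Fa := subsetP sF1 a Ta; exists a; first by [].
rewrite comm_transvJ // defL defw.
have -> : z * u = u ^ a by rewrite (centsP cVV z Vz u Vu) defz conjg_mulR.
rewrite cycleJ; congr (_ :^ a); apply/esym/nt_gen_prime.
  by rewrite card_comm_transv.
by rewrite !inE u2 andbT; apply: contraNneq ncu => ->.
Qed.

(** The hyperplane of T meets the plane U in a nontrivial vector, whose line is that of T1 or of a
    T1-conjugate of T2. As T centralises this line, [transv_comm_move] leaves only equality. *)
Lemma transv_pair_hull T : transv T -> T \subset N <*> T1 ->
  T :=: T1 \/ exists2 a, a \in T1 & T :=: T2 :^ a.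
Proof.
move=> tT sT; have [sTF oT iT] := transvP tT.
have [sF1 _ _] := transvP tT1.
have /(Cauchy p_pr)[x /setIP[Ux /setIP[Vx cx]] ox] : p %| #|U :&: 'C_V(T)|.
  have pI : p.-group (U :&: 'C_V(T)).
    by apply: pgroupS pV; rewrite subIset ?sUV.
  have [/= E|/(pgroup_pdiv pI)[] //] := eqVneq (U :&: 'C_V(T))%G 1%G.
  have {}E : U :&: 'C_V(T) = 1 by rewrite -[LHS]/(gval (U :&: 'C_V(T))%G) E.
  have := subset_leq_card (_ : U * 'C_V(T) \subset V).
  rewrite mul_subG ?subsetIl // TI_cardMg // card_transv_pair.
  rewrite -(Lagrange (subsetIl V 'C(T))) iT mulnC leq_pmul2l ?cardG_gt0 //.
  by move/(_ isT); rewrite leqNgt -{1}(expn1 p) ltn_exp2l ?prime_gt1.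
have sxC : <[x]> \subset 'C(T) by rewrite cycle_subG.
have eqNT : N <*> T = N <*> T1 by rewrite (joing_transv_eq tT1).
have [||E|[a Ta E]] := @transv_pair_line <[x]>%G; rewrite ?cycle_subG //.
  left; apply/eqP; apply: contraLR sxC => neq; rewrite E transv_comm_move //.
  by rewrite eqNT joing_subr.
right; exists a => //; apply/eqP; apply: contraLR sxC => neq; rewrite E.
have Fa := subsetP sF1 a Ta.
apply: (@transv_comm_move T (T2 :^ a)%G) => //; first exact: transvJ.
rewrite eqNT /= -(conjGid (_ : a \in N <*> T1)) ?conjSg //.
exact: subsetP (joing_subr _ _) a Ta.
Qed.

End Pair.

(** If N normalised T, then [N, T] would lie in the trivial intersection of N and T, against
    [cNp]. *)
Lemma transv_partner T : transv T -> exists2 n, n \in N & T :!=: T :^ n.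
Proof.
move=> tT; have [sTF oT iT] := transvP tT.
have [/existsP[n /andP[Nn ne]]|] := boolP [exists n, (n \in N) && (T :!=: T :^ n)].
  by exists n.
rewrite negb_exists => /forallP fixT.
have nTN : N \subset 'N(T).
  apply/normsP=> n Nn; apply/eqP; move/implyP: (fixT n).
  by have:= fixT n; rewrite Nn /= negbK eq_sym.
have cTN : T \subset 'C(N).
  rewrite centsC; apply/commG1P/trivgP.
  have coNT : coprime #|N| #|T| by rewrite coprime_sym (pnat_coprime (transv_pgroup tT)).
  by rewrite -(coprime_TIg coNT) subsetI commg_subl (subset_trans sTF nNF) commg_subr.
have := cNp sTF (transv_pgroup tT); rewrite (setIidPl cTN) => T1.
by move: p_pr; rewrite -oT T1 cards1.
Qed.

Lemma transv_sub_partner T n : n \in N -> T :^ n \subset N <*> T.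
Proof.
move=> Nn; rewrite -(conjGid (_ : n \in N <*> T)) ?conjSg ?joing_subr //.
exact: subsetP (joing_subl _ _) n Nn.
Qed.

(* The direct factors E_i of the theorem are the hulls of the transvection
   groups; any two distinct transvection groups of a hull generate it. *)
Definition hull T : {group gT} :=
  <<(\bigcup_(S : {group gT} | transv S && (S \subset N <*> T)) S)%g>>%G.

Lemma sub_hull T S : transv S -> S \subset N <*> T -> S \subset hull T.
Proof.
by move=> tS sS; apply: sub_gen; apply: (bigcup_max S); rewrite ?tS.
Qed.

Lemma transv_hull T : transv T -> T \subset hull T.
Proof. by move=> tT; rewrite sub_hull ?joing_subr. Qed.

Lemma hull_sub T : transv T -> hull T \subset N <*> T.
Proof. by move=> tT; rewrite gen_subG; apply/bigcupsP=> S /andP[]. Qed.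

Lemma hull_subF T : transv T -> hull T \subset F.
Proof.
move=> tT; rewrite (subset_trans (hull_sub tT)) // join_subG sNF.
by case/transvP: tT.
Qed.

Lemma hull_congr T T' : N <*> T = N <*> T' -> hull T = hull T'.
Proof.
by move=> E; apply/val_inj; congr <<_>>; apply: eq_bigl => S; rewrite E.
Qed.

Lemma hull_pair T S : transv T -> transv S -> S \subset N <*> T ->
  T :!=: S -> hull T = (T <*> S)%G.
Proof.
move=> tT tS sS neq; apply/val_inj/eqP; rewrite /= eqEsubset gen_subG.
apply/andP; split; last by rewrite join_subG !sub_hull ?joing_subr.
apply/bigcupsP=> R /andP[tR sR].
have [->|[a Ta ->]] := transv_pair_hull tT tS sS neq tR sR.
  exact: joing_subl.
rewrite -(conjGid (_ : a \in T <*> S)) ?conjSg ?joing_subr //.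
exact: subsetP (joing_subl _ _) a Ta.
Qed.

Lemma hull_norm T A : A \subset F -> A \subset 'N(N <*> T) ->
  A \subset 'N(hull T).
Proof.
move=> sAF nA; apply/subsetP=> a Aa; have Fa := subsetP sAF a Aa.
rewrite inE /= -genJ -bigcupJ gen_subG; apply/bigcupsP=> S /andP[tS sS].
apply: (@sub_hull T (S :^ a)%G); first exact: transvJ.
by rewrite /= -(normsP nA a Aa) conjSg.
Qed.

Lemma hull_normN T : N \subset 'N(hull T).
Proof. by rewrite hull_norm // (subset_trans (joing_subl N T)) ?normG. Qed.

(** * The action of a hull on V *)

Section Hull.
Variable T : {group gT}.
Hypothesis tT : transv T.
Let X := hull T.
Let U := [~: V, X]%G.

Let pairX : exists2 S : {group gT}, [/\ transv S, S \subset N <*> T & T :!=: S]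
  & X = (T <*> S)%G.
Proof.
have [n Nn ne] := transv_partner tT.
have Fn := subsetP sNF n Nn; have tS := transvJ Fn tT.
have sS := transv_sub_partner T Nn; exists (T :^ n)%G; first by split.
exact: hull_pair.
Qed.

Lemma card_hull_comm : #|U| = (p ^ 2)%N.
Proof.
have [S [tS sS ne] defX] := pairX.
by rewrite /U defX /= comm_transv_pair // card_transv_pair.
Qed.

Lemma hull_dprod : U \x 'C_V(X) = V.
Proof.
have [S [tS sS ne] defX] := pairX.
rewrite -[RHS](transv_pair_dprod tT tS sS ne).
by rewrite /U defX /= comm_transv_pair.
Qed.

Lemma hull_faithful : 'C_X(U) = 1.
Proof.
apply/trivgP; rewrite -cFV subsetI (subset_trans (subsetIl _ _)) ?hull_subF //=.
rewrite centsC; have [_ defV _ _] := dprodP hull_dprod.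
rewrite -{1}defV mul_subG //.
  by rewrite centsC subsetIr.
by rewrite centsC subIset // centsC subsetIr.
Qed.

Lemma hull_line L : L \subset U -> #|L| = p ->
  exists2 S : {group gT}, transv S && (S \subset N <*> T) & L :=: [~: V, S].
Proof.
have [S [tS sS ne] defX] := pairX; rewrite /U defX /= comm_transv_pair //.
move=> sL oL; have [->|[a Ta ->]] := transv_pair_line tT tS sS ne sL oL.
  by exists T; rewrite ?tT ?joing_subr.
have Fa : a \in F by case/transvP: tT => /subsetP/(_ a Ta).
exists (S :^ a)%G; rewrite ?transvJ //=.
rewrite -(conjGid (_ : a \in N <*> T)) ?conjSg //.
exact: subsetP (joing_subr _ _) a Ta.
Qed.

(** A line of U is [V, S] for a transvection group S of the hull, and S does not centralise the line
    of an N-conjugate distinct from S; hence N moves every line. *)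
Lemma hull_irr R : R \subset U -> N \subset 'N(R) -> R :=: 1 \/ R :=: U.
Proof.
move=> sRU nRN; have := cardSg sRU; rewrite card_hull_comm.
case/(dvdn_pfactor _ _ p_pr)=> [[|[|[|//]]]] _ oR.
- by left; apply: card1_trivg.
- have [S /andP[tS sS] defR] := hull_line sRU oR.
  have [n Nn ne] := transv_partner tS; have Fn := subsetP sNF n Nn.
  have tSn := transvJ Fn tS; have sSn := transv_sub_partner S Nn.
  have := transv_comm_move tS tSn sSn ne; rewrite /= comm_transvJ // -defR.
  by rewrite (normsP nRN) // defR centsC transv_cent_comm.
by right; apply/eqP; rewrite eqEcard sRU oR card_hull_comm leqnn.
Qed.

Lemma hull_mul : (N :&: X) * T = X.
Proof.
have [sTF oT iT] := transvP tT.
rewrite setIC group_modr ?transv_hull //; apply/setIidPl.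
by rewrite -norm_joinEr ?hull_sub // (subset_trans sTF).
Qed.

Lemma hull_core_neq1 : N :&: X != 1.
Proof.
have [S [tS sS ne] defX] := pairX.
apply: contraNneq ne => D1; have := hull_mul; rewrite D1 mul1g => defT.
have [_ oT _] := transvP tT; have [_ oS _] := transvP tS.
by rewrite eq_sym eqEcard oT oS leqnn andbT defT defX joing_subr.
Qed.

Lemma hull_commN : N \subset 'N(U).
Proof. by rewrite normsR // hull_normN. Qed.

(** This replaces X by its p'-part, which N normalises and which acts coprimely on V. By
    irreducibility the fixed points of this part in U are 1 or U, and faithfulness excludes U. *)
Lemma cent_hull_core : 'C_V(N :&: X) = 'C_V(X).
Proof.
have nDN : N \subset 'N(N :&: X) by rewrite normsI ?normG ?hull_normN.
have [_ defV cUC tiU] := dprodP hull_dprod.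
have sCC : 'C_V(X) \subset 'C_V(N :&: X) by rewrite setIS // centS ?subsetIr.
have sUV : U \subset V by rewrite commg_subl (subset_trans (hull_subF tT)).
have [||C1|CU] := @hull_irr ('C_U(N :&: X))%G; first exact: subsetIl.
- by rewrite normsI ?hull_commN // norms_cent.
- have := group_modr U sCC; rewrite defV (setIidPl (subsetIl V _)) => <-.
  have -> : 'C_V(N :&: X) :&: U = 1.
    by rewrite setIC setIA (setIidPl sUV) -[LHS]/(gval ('C_U(N :&: X))%G) C1.
  by rewrite mul1g.
case/negP: hull_core_neq1; rewrite -subG1 -hull_faithful subsetI subsetIr /=.
by rewrite centsC; apply/setIidPl; rewrite -[LHS]/(gval ('C_U(N :&: X))%G) CU.
Qed.

(** Inside a hull the axis of S is thus determined by its line, the missing input for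
    [transv_eq]. *)
Lemma transv_cent_hull S : transv S -> S \subset N <*> T ->
  [~: V, S] * 'C_V(X) = 'C_V(S).
Proof.
move=> tS sS; have sSX : S \subset X by apply: sub_hull.
have [_ defV cUC tiU] := dprodP hull_dprod.
have slU : [~: V, S] \subset U by apply: commgS.
apply/eqP; rewrite eqEcard mul_subG /=; last first.
- by rewrite setIS // centS.
- by rewrite subsetI comm_transv_sub // centsC transv_cent_comm.
rewrite TI_cardMg; last by apply/trivgP; rewrite -tiU setSI.
have [_ _ iS] := transvP tS; rewrite card_comm_transv //.
rewrite -(leq_pmul2l (prime_gt0 p_pr)) mulnA mulnn -card_hull_comm.
rewrite -TI_cardMg // -[X in _ <= #|pred_of_set X|]/(gval _ * _) defV.
by rewrite -(Lagrange (subsetIl V 'C(S))) iS mulnC.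
Qed.

End Hull.

(** The two planes meet in 1 or coincide, by irreducibility under N. In the first case the p'-part
    of one hull centralises the plane of the other. In the second the hulls have the same fixed
    points in V, so T' has the line and the axis of a transvection group of [hull T], and the hulls
    are equal. *)
Lemma hull_comm_cent T T' : transv T -> transv T' -> hull T <> hull T' ->
  [~: V, hull T'] \subset 'C(hull T).
Proof.
move=> tT tT' neX; pose X := hull T; pose X' := hull T'.
pose U := [~: V, X]%G; pose U' := [~: V, X']%G.
have sU'V : U' \subset V by rewrite commg_subl (subset_trans (hull_subF tT')).
have [_ defV _ tiU] := dprodP (hull_dprod tT).
have [_ defV' _ tiU'] := dprodP (hull_dprod tT').
have nR : N \subset 'N(U :&: U') by rewrite normsI ?hull_commN.
have DN (A : {group gT}) : N \subset 'N(A) -> [~: A, N :&: X] \subset A.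
  by move=> nA; rewrite commg_subl subIset ?nA.
have [R1|RU] := hull_irr tT (subsetIl _ _) nR.
  have: [~: U', N :&: X] \subset 1%G.
    rewrite /= -R1 subsetI DN ?hull_commN // andbT.
    by rewrite commgSS ?subsetIr.
  move/trivgP/commG1P=> cU'D; have : U' \subset 'C_V(N :&: X) by rewrite subsetI sU'V.
  by rewrite cent_hull_core // subsetI => /andP[].
have sUU' : U \subset U' by rewrite -RU subsetIr.
have eqU : U :=: U' by apply/eqP; rewrite eqEcard sUU' !card_hull_comm // leqnn.
case: neX; have eqC : 'C_V(X) = 'C_V(X').
  apply/eqP; rewrite eqEcard; apply/andP; split; last first.
    rewrite -(leq_pmul2l (cardG_gt0 U)) {1}eqU -!TI_cardMg //.
    by rewrite -[X in #|pred_of_set X| <= _]/(gval U' * _) defV' defV.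
  rewrite -(cent_hull_core tT') subsetI subsetIl /=; apply/commG1P/trivgP.
  rewrite -tiU subsetI [X in X && _](_ : _ = true); last first.
    by rewrite eqU commgSS ?subsetIl ?subsetIr.
  rewrite -(cent_hull_core tT) commg_subl subIset // normsI ?norms_cent //.
  by rewrite normsI ?normG ?hull_normN.
have [S /andP[tS sS] eql] : exists2 S : {group gT},
    transv S && (S \subset N <*> T) & [~: V, T'] = [~: V, S].
  apply: (hull_line tT (L := [~: V, T']%G)); last exact: card_comm_transv.
  by rewrite /= -/U eqU commgS ?transv_hull.
have eqS : S :=: T'.
  apply: transv_eq => //; rewrite -(transv_cent_hull tT) // -eql.
  by rewrite -(transv_cent_hull tT' tT') ?joing_subr // eqC.
by apply: hull_congr; rewrite -(joing_transv_eq tT tS) // eqS.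
Qed.

(** Each hull centralises the plane of the other, so by the three subgroup lemma their commutator
    centralises V. *)
Lemma hull_commute T T' : transv T -> transv T' -> hull T <> hull T' ->
  hull T' \subset 'C(hull T).
Proof.
move=> tT tT' neX; have sXF := hull_subF tT; have sX'F := hull_subF tT'.
rewrite centsC; apply/commG1P.
suffices : [~: hull T, hull T'] \subset 'C_F(V) by rewrite cFV => /trivgP.
rewrite subsetI (subset_trans (commgSS sXF sX'F)) ?commg_subl ?normG //= centsC.
apply/commG1P; rewrite commGC.
apply: three_subgroup.
  by apply/commG1P; rewrite commGC hull_comm_cent.
by apply/commG1P; apply: hull_comm_cent => // /esym.
Qed.

(** Counterpart of [best_offenders] with A and V in one group and conjugation as the action;
    [best_sdpair] links the two. *)
Definition best A := [&& p.-abelem A, A \subset F &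
  [forall B : {group gT}, (B \subset A) ==>
     (#|B| * #|'C_V(B)| <= #|A| * #|'C_V(A)|)%N]].

Lemma bestP A : reflect [/\ p.-abelem A, A \subset F & forall B, B \subset A ->
    (#|B| * #|'C_V(B)| <= #|A| * #|'C_V(A)|)%N] (best A).
Proof.
apply: (iffP and3P) => [] [abA sAF leA]; split=> //.
  by move=> B sBA; apply: (implyP (forallP leA B)).
by apply/forallP=> B; apply/implyP/leA.
Qed.

Lemma best_sub A B : best A -> B \subset A ->
  #|A| * #|'C_V(A)| <= #|B| * #|'C_V(B)| -> best B.
Proof.
case/bestP=> abA sAF leA sBA leAB; apply/bestP; split.
- exact: abelemS abA.
- exact: subset_trans sAF.
by move=> C sCB; apply: leq_trans leAB; apply: leA; apply: subset_trans sBA.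
Qed.

Lemma pgroup_index_ge A B : p.-group A -> B \subset A -> ~~ (A \subset B) ->
  p * #|B| <= #|A|.
Proof.
move=> pA sBA nsAB; rewrite -(Lagrange sBA) mulnC leq_pmul2l ?cardG_gt0 //.
have pI : p.-nat #|A : B| := pnat_dvd (dvdn_indexg _ _) pA.
have [k oI] := p_natP pI; rewrite -indexg_gt1 oI in nsAB *.
by case: k nsAB {oI} => // k _; rewrite expnS leq_pmulr // expn_gt0 prime_gt0.
Qed.

(* In a minimal best offender T, the A x B lemma turns a hyperplane B with
   [~: 'C_N(B), T] nontrivial into a best offender, so B = 1. *)
Lemma best_transv A : best A -> A :!=: 1 ->
  exists2 T : {group gT}, transv T & T \subset A.
Proof.
move=> bA ntA.
have [T /mingroupP[/andP[bT ntT] minT] sTA] :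
    {T : {group gT} | [min T | best T & T :!=: 1] & T \subset A}.
  by apply: mingroup_exists; rewrite bA.
exists T => //; have [abT sTF leT] := bestP T bT.
have [pT cTT] := (abelem_pgroup abT, abelem_abelian abT).
have ncNT : ~~ (T \subset 'C(N)).
  by apply: contra ntT => /setIidPl E; rewrite -E (cNp sTF pT).
have nVT : T \subset 'N(V) := subset_trans sTF nVF.
have nNT : T \subset 'N(N) := subset_trans sTF nNF.
have [B [sBT iB ncB]] := abelem_hyperplane_nontriv p_pr abT p'N solN nNT ncNT.
pose M := ('C_N(B))%G.
have sMN : M \subset N := subsetIl _ _.
have nBT : T \subset 'N(B) by rewrite cents_norm // (subset_trans cTT) ?centS.
have nMT : T \subset 'N(M) by rewrite normsI // norms_cent.
have nCM : M \subset 'N('C_V(B)).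
  apply: normsI; first exact: subset_trans sMN nVN.
  by rewrite norms_cent // cents_norm // subsetIr.
(* Otherwise [M, T] centralises ['C_V(B)], hence V by the A x B lemma; by faithfulness T then
   centralises M, against the choice of B. *)
have ncC : ~~ (T \subset 'C('C_V(B))).
  apply: contra ncB => cT; rewrite centsC; apply/commG1P.
  have sKM : [~: M, T] \subset M by rewrite commg_subl.
  have cK : [~: M, T] \subset 'C(V).
    apply: (coprime_cent_faithful (p := p) (B := B)) => //.
    - exact: pgroupS pT.
    - exact: pgroupS (subset_trans sKM sMN) p'N.
    - exact: subset_trans nVT.
    - exact: subset_trans sKM (subset_trans sMN nVN).
    - by rewrite centsC (subset_trans sKM) // subsetIr.
    rewrite (subset_trans (commgS _ cT)) // commg_subr.
    exact: subset_trans nCM (cent_norm _).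
  apply/trivgP; rewrite -cFV subsetI cK andbT.
  exact: subset_trans sKM (subset_trans sMN sNF).
have oT : #|T| = (p * #|B|)%N by rewrite -(Lagrange sBT) iB mulnC.
have leC : p * #|'C_V(T)| <= #|'C_V(B)|.
  apply: pgroup_index_ge; first exact: pgroupS (subsetIl _ _) pV.
    by rewrite setIS ?centS.
  by apply: contra ncC => /subsetIP[_]; rewrite centsC.
(* Passing from T to B loses a factor p in the order and gains at least p in the fixed points. *)
have leTB : #|T| * #|'C_V(T)| <= #|B| * #|'C_V(B)|.
  by rewrite oT -mulnA mulnCA leq_mul2l leC orbT.
have B1 : B :=: 1.
  apply/eqP/negPn/negP=> ntB; have bB := best_sub bT sBT leTB.
  have := minT B; rewrite bB ntB => /(_ isT sBT) E.
  by move: p_pr; rewrite -iB E indexgg.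
have {}oT : #|T| = p by rewrite oT B1 cards1 muln1.
rewrite /transv sTF oT eqxx /=.
(* Comparison with the trivial subgroup bounds the index of ['C_V(T)] by p from above; [leC] with B
   = 1 bounds it from below. *)
have := leT 1%G (sub1G _); rewrite cards1 mul1n cent1T setIT oT.
rewrite B1 cent1T setIT in leC => leV.
have {leC leV} : (#|V : 'C_V(T)| * #|'C_V(T)| == p * #|'C_V(T)|)%N.
  by rewrite mulnC Lagrange ?subsetIl // eqn_leq leV leC.
by rewrite eqn_pmul2r ?cardG_gt0.
Qed.

Definition transv_in A : {set {group gT}} := [set T : {group gT} | transv T && (T \subset A)].

(* Induction on A: A = T * 'C_A([~: V, hull T]) for each transvection group T of
   A, and the second factor is again a best offender. *)
Lemma best_gen A : best A ->
  <<\bigcup_(T in transv_in A) T>> = A /\ (#|A| * #|'C_V(A)| = #|V|)%N.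
Proof.
move: {2}#|A|.+1 (ltnSn #|A|) => n; elim: n A => // n IH A ltAn bA.
have sgA : <<\bigcup_(T in transv_in A) T>> \subset A.
  by rewrite gen_subG; apply/bigcupsP=> T; rewrite inE => /andP[].
have [A1|ntA] := eqVneq (gval A) 1.
  split; last by rewrite A1 cards1 mul1n cent1T setIT.
  by apply/eqP; rewrite eqEsubset sgA {1}A1 sub1G.
have [T tT sTA] := best_transv bA ntA; have [abA sAF leA] := bestP A bA.
have [pA cAA] := (abelem_pgroup abA, abelem_abelian abA).
pose X := hull T; pose U := [~: V, X]%G; pose B := ('C_A(U))%G.
have sBA : B \subset A := subsetIl _ _.
have nVA : A \subset 'N(V) := subset_trans sAF nVF.
have cAT : A \subset 'C(T) by rewrite (subset_trans cAA) ?centS.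
have nXA : A \subset 'N(X).
  apply: hull_norm => //; apply: normsY; first exact: subset_trans sAF nNF.
  exact: cents_norm.
have nUA : A \subset 'N(U) by rewrite normsR.
have sUV : U \subset V by rewrite commg_subl (subset_trans (hull_subF tT)).
have sTX := transv_hull tT.
have slU : [~: V, T] \subset U by rewrite commgS.
have ncUT : ~~ (U \subset 'C(T)).
  rewrite centsC; apply/negP=> cTU; have [_ oT _] := transvP tT.
  have : T \subset 'C_X(U) by rewrite subsetI sTX.
  by rewrite (hull_faithful tT) => /trivgP T1; move: p_pr; rewrite -oT T1 cards1.
have [u Uu ncu] := subsetPn ncUT; have Vu := subsetP sUV u Uu.
have {}ncu : ~~ (T \subset 'C[u]) by rewrite sub_cent1.
have nlA : A \subset 'N([~: V, T]) by rewrite normsR // cents_norm.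
have clA : A \subset 'C([~: V, T]).
  exact: pgroup_cent_prime p_pr (card_comm_transv tT) pA nlA.
have defU : [~: V, T] * <[u]> = U.
  apply/eqP; rewrite eqEsubset mul_subG ?cycle_subG //=.
  have sU : U \subset (U :&: 'C_V(T)) * <[u]>.
    by rewrite group_modr ?cycle_subG // (transv_span tT Vu ncu) subsetI sUV subxx.
  apply: subset_trans sU _; rewrite mulSg // -(transv_cent_hull tT tT) ?joing_subr //.
  rewrite setIC -group_modl //; have [_ _ _ tiU] := dprodP (hull_dprod tT).
  by rewrite setIC tiU mulg1.
(* The quotient of U by the line [V, T] has order p, so the p-group A acts trivially on it. *)
have cUA : [~: U, A] \subset [~: V, T].
  have nlU : U \subset 'N([~: V, T]).
    exact: sub_abelian_norm (abelianS sUV cVV) slU.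
  rewrite -quotient_cents2 // centsC.
  apply: (pgroup_cent_prime p_pr (R := (U / [~: V, T])%G)).
  - rewrite card_quotient //; have /eqP := Lagrange slU.
    rewrite card_comm_transv // [X in _ == X](card_hull_comm tT) -mulnn.
    by rewrite eqn_pmul2l ?prime_gt0 // => /eqP.
  - exact: quotient_pgroup.
  exact: quotient_norms.
(* Each a in A moves u along [V, T], as some t in T does; t^-1 a then fixes u and the line, which
   span U. *)
have defA : T * B = A.
  apply/eqP; rewrite eqEsubset mul_subG //=; apply/subsetP=> a Aa.
  have : [~ u, a] \in [~: V, T] by rewrite (subsetP cUA) // mem_commg.
  rewrite -(comm_transv_image tT Vu ncu) => /imsetP[t Tt /mulgI Eat].
  have At := subsetP sTA t Tt.
  rewrite -(mulKVg t a) mem_mulg // inE groupM ?groupV //=.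
  rewrite -sub_cent1 -defU mul_subG //.
    by rewrite sub_cent1 (subsetP clA) // groupM ?groupV.
  rewrite cycle_subG; apply/cent1P/commgP/conjg_fixP.
  rewrite (centsP cAA _ (groupVr At) a Aa).
  by rewrite conjgM Eat -conjgM mulgV conjg1.
have psBA : B \proper A.
  rewrite properE sBA; apply: contra ncUT => sAB.
  by rewrite centsC (subset_trans sTA) // (subset_trans sAB) ?subsetIr.
have oA : #|A| <= p * #|B|.
  by have [_ <- _] := transvP tT; rewrite -defA mul_cardG leq_pmulr ?cardG_gt0.
have leC : p * #|'C_V(A)| <= #|'C_V(B)|.
  apply: pgroup_index_ge; first exact: pgroupS (subsetIl _ _) pV.
    by rewrite setIS ?centS.
  apply: contra ncUT => sC; apply: (@subset_trans _ _ 'C_V(B)).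
    by rewrite subsetI sUV centsC subsetIr.
  by rewrite (subset_trans sC) // subIset // centS ?orbT.
have leAB : #|A| * #|'C_V(A)| <= #|B| * #|'C_V(B)|.
  rewrite (leq_trans (leq_mul oA (leqnn _))) // -mulnA mulnCA leq_mul2l leC.
  by rewrite orbT.
have bB := best_sub bA sBA leAB.
have [defB oB] := IH B (leq_trans (proper_card psBA) ltAn) bB.
split; last by rewrite -oB; apply/eqP; rewrite eqn_leq leAB leA.
apply/eqP; rewrite eqEsubset sgA -{1}defA mul_subG //=.
  by rewrite sub_gen // (bigcup_max T) // inE tT.
rewrite -defB genS //; apply/bigcupsP=> S; rewrite inE => /andP[tS sS].
by rewrite (bigcup_max S) // inE tS (subset_trans sS).
Qed.

Lemma hull_comm_core T : transv T -> [~: V, N :&: hull T] = [~: V, hull T].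
Proof.
move=> tT; have sD : [~: V, N :&: hull T] \subset [~: V, hull T]%G.
  by rewrite commgS // subsetIr.
have nD : N \subset 'N([~: V, N :&: hull T]).
  by rewrite normsR // normsI ?normG ?hull_normN.
have [D1|//] := hull_irr tT (R := [~: V, N :&: hull T]%G) sD nD.
case/negP: (hull_core_neq1 tT); rewrite -subG1 -cFV subsetI.
by rewrite subIset ?sNF //= centsC; apply/commG1P.
Qed.

Lemma hull_subH (H : {group gT}) T : N \subset 'N(H) -> transv T -> T \subset H ->
  hull T \subset H.
Proof.
move=> nHN tT sTH; have [n Nn ne] := transv_partner tT.
have Fn := subsetP sNF n Nn; have tS := transvJ Fn tT.
rewrite (hull_pair tT tS (transv_sub_partner T Nn) ne) join_subG sTH /=.
by rewrite -(normsP nHN n Nn) conjSg.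
Qed.

(** Generators of the two lines form a basis of the plane. By [comm_transv_image], T1 and T2 act on
    it as the full lower and upper unitriangular groups. The normal p-complement that bounds p is
    the intersection of N and X. *)
Lemma transv_pair_SL2 T1 T2 : transv T1 -> transv T2 -> T2 \subset N <*> T1 ->
  T1 :!=: T2 -> T1 <*> T2 \isog SL2 p /\ (p = 2 \/ p = 3).
Proof.
move=> tT1 tT2 sT2 ne; pose X := (T1 <*> T2)%G.
have defX : X = hull T1 by rewrite (hull_pair tT1 tT2 sT2 ne).
pose U := ([~: V, X])%G; have sXF : X \subset F by rewrite defX hull_subF.
have nUX : X \subset 'N(U) by rewrite /U /= commg_normr.
have sUV : U \subset V by rewrite commg_subl (subset_trans sXF).
have abU : p.-abelem U := abelemS sUV abV.
have oU : #|U| = (p ^ 2)%N by rewrite /U defX card_hull_comm.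
have ntU : U :!=: 1 by rewrite -cardG_gt1 oU -{1}(expn0 p) ltn_exp2l ?prime_gt1.
have sT1 : T1 \subset X := joing_subl _ _.
have sT2X : T2 \subset X := joing_subr _ _.
have sT1N : T1 \subset N <*> T2 by rewrite (joing_transv_eq tT1 tT2 sT2) joing_subr.
have mv12 : ~~ ([~: V, T2] \subset 'C(T1)) by apply: transv_comm_move.
have mv21 : ~~ ([~: V, T1] \subset 'C(T2)) by rewrite transv_comm_move // eq_sym.
have lU S : S \subset X -> [~: V, S] \subset U by apply: commgS.
have genl S S' : transv S -> ~~ ([~: V, S] \subset 'C(S')) ->
    exists2 u, [~: V, S] = <[u]> & ~~ (S' \subset 'C[u]).
  move=> tS ncS; have [u lu ncu] := subsetPn ncS; exists u; last by rewrite sub_cent1.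
  apply: nt_gen_prime; first by rewrite card_comm_transv.
  by rewrite !inE lu andbT; apply: contraNneq ncu => ->.
have [u1 defl1 nc1] := genl T1 T2 tT1 mv21; have [u2 defl2 nc2] := genl T2 T1 tT2 mv12.
have Uu1 : u1 \in U by rewrite -cycle_subG -defl1 lU.
have Uu2 : u2 \in U by rewrite -cycle_subG -defl2 lU.
pose rG := abelem_repr abU ntU nUX; pose r := abelem_rV abU ntU.
have n2 : (abelem_dim' U).+1 = 2 by rewrite (dim_abelemE abU ntU) oU pfactorK.
have injG : mx_faithful rG.
  by apply: abelem_mx_faithful; rewrite -(hull_faithful tT1) /U defX.
have act S u u' : transv S -> S \subset X -> [~: V, S] = <[u]> ->
    ~~ (S \subset 'C[u']) -> u \in U -> u' \in U ->
    (forall t, t \in S -> r u *m rG t = r u /\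
       exists c, r u' *m rG t = r u' + c *: r u)%R /\
    (forall c, exists2 t, t \in S & r u' *m rG t = r u' + c *: r u)%R.
  move=> tS sS defl nc Uu Uu'; have Vu' := subsetP sUV u' Uu'.
  have cS := transv_cent_comm tS; have im := comm_transv_image tS Vu' nc.
  split=> [t St|c].
    have Xt := subsetP sS t St; rewrite -!abelem_rV_J //; split.
      congr (r _); apply/conjg_fixP/commgP/commute_sym/cent1P.
      by rewrite defl cent_cycle in cS; apply: (subsetP cS).
    have : [~ u', t] \in <[u]> by rewrite -defl mem_commg.
    case/cycleP=> k Ek; exists k%:R%R; rewrite conjg_mulR Ek.
    by rewrite abelem_rV_M ?groupX // abelem_rV_X.
  have : u ^+ c \in [~: V, S] by rewrite defl mem_cycle.
  rewrite -im => /imsetP[t St Et]; exists t => //; have Xt := subsetP sS t St.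
  by rewrite -abelem_rV_J // conjg_mulR -Et abelem_rV_M ?groupX // abelem_rV_X // natr_Zp.
have [lowT Tlow] := act T1 u1 u2 tT1 sT1 defl1 nc2 Uu1 Uu2.
have [upT Tup] := act T2 u2 u1 tT2 sT2X defl2 nc1 Uu2 Uu1.
have nz1 : (r u1 != 0)%R.
  apply: contraNneq nc1; rewrite -(abelem_rV_1 abU ntU) => /abelem_rV_inj -> //.
  by apply/subsetP=> t _; apply/cent1P/commute1.
have ind c : (r u2 <> c *: r u1)%R.
  rewrite -[c]natr_Zp -abelem_rV_X // => /abelem_rV_inj E; case/negP: nc2.
  rewrite sub_cent1 E ?groupX //.
  by rewrite -cycle_subG -defl1 centsC transv_cent_comm.
have [rB [injB lowB Blow upB Bup]] :=
  repr_basis2 n2 injG sT1 sT2X nz1 ind lowT Tlow upT Tup.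
have eX : X :=: T1 <*> T2 by [].
split; first exact: (repr_SL2_isog injB eX lowB Blow upB Bup).
apply: (repr_SL2_prime p_pr injB eX Blow Bup (D := (N :&: X)%G)).
- by rewrite /normal subsetIr normsI ?normG // (subset_trans sXF).
- exact: pgroupS (subsetIl _ _) p'N.
- have := hull_mul tT1; rewrite -defX => <-.
  by rewrite /= -/X quotientMidl quotient_pgroup // transv_pgroup.
exact: transv_pgroup.
Qed.

Lemma hull_SL2 T : transv T -> hull T \isog SL2 p /\ (p = 2 \/ p = 3).
Proof.
move=> tT; have [n Nn ne] := transv_partner tT.
have tS := transvJ (subsetP sNF n Nn) tT; have sS := transv_sub_partner T Nn.
by rewrite (hull_pair tT tS sS ne); apply: transv_pair_SL2.
Qed.

(** * The direct decomposition of a group generated by best offenders *)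

Variable H : {group gT}.
Hypotheses (sHF : H \subset F) (nHN : N \subset 'N(H)).
Hypothesis genH :
  <<\bigcup_(A : {group gT} | best A && (A \subset H)) A>> = H.

(** Many transvection groups share a hull; the image set counts each hull once, so that distinct
    indices give distinct, hence commuting, factors. *)
Definition hulls : {set {group gT}} := [set hull T | T in transv_in H].

Definition hull_nth (i : 'I_#|hulls|) : {group gT} := enum_val i.
Local Notation E := hull_nth.

Lemma hull_nthP i : exists2 T : {group gT}, transv T && (T \subset H) & E i = hull T.
Proof.
have : E i \in hulls := enum_valP i.
by case/imsetP=> T; rewrite inE => tT ->; exists T.
Qed.

Lemma hull_nth_ex T : transv T -> T \subset H -> exists i, E i = hull T.
Proof.
move=> tT sT; have hT : hull T \in hulls by rewrite imset_f // inE tT.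
by exists (enum_rank_in hT (hull T)); apply: enum_rankK_in.
Qed.

Lemma hull_nth_cent i j : i != j -> [~: V, E i] \subset 'C(E j).
Proof.
move=> neq; have : E i <> E j by move/enum_val_inj=> E; rewrite E eqxx in neq.
have [[T /andP[tT _] ->] [T' /andP[tT' _] ->]] := (hull_nthP i, hull_nthP j).
by move=> ne; apply: hull_comm_cent => // /esym.
Qed.

Lemma hull_nth_comm i j : i != j -> E i \subset 'C(E j).
Proof.
move=> neq; have : E i <> E j by move/enum_val_inj=> E; rewrite E eqxx in neq.
have [[T /andP[tT _] ->] [T' /andP[tT' _] ->]] := (hull_nthP i, hull_nthP j).
by move=> ne; apply: hull_commute => // /esym.
Qed.

Lemma hull_nth_sub i : E i \subset H.
Proof. by have [T /andP[tT sT] ->] := hull_nthP i; apply: hull_subH. Qed.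

Lemma hull_nth_faithful i : 'C_(E i)([~: V, E i]) = 1.
Proof. by have [T /andP[tT _] ->] := hull_nthP i; apply: (hull_faithful tT). Qed.

(** The other factors centralise [V, E i], on which E i is faithful. *)
Lemma hull_nth_TI i : E i :&: <<\bigcup_(j | j != i) E j>> = 1.
Proof.
apply/trivgP; rewrite -(hull_nth_faithful i) setIS // gen_subG.
by apply/bigcupsP=> j neq; rewrite centsC hull_nth_cent // eq_sym.
Qed.

Lemma best_nth A : best A -> A \subset H ->
  \big[dprod/1]_i (A :&: E i) = A /\ (#|A| * #|'C_V(A)| = #|V|)%N.
Proof.
move=> bA sAH; have [defA ->] := best_gen bA; split=> //.
apply: (bigdprod_gen (F := fun i => (A :&: E i)%G)) => [i j ne|i|].
- rewrite (subset_trans (subsetIr _ _)) // (subset_trans (hull_nth_comm ne)) //.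
  by rewrite centS ?subsetIr.
- apply/trivgP; rewrite -(hull_nth_TI i) setISS ?subsetIr // genS //.
  by apply/bigcupsP=> j ne; rewrite (bigcup_max j) ?subsetIr.
apply/eqP; rewrite eqEsubset gen_subG; apply/andP; split.
  by apply/bigcupsP=> i _; apply: subsetIl.
rewrite -{1}defA genS //; apply/bigcupsP=> T; rewrite inE => /andP[tT sTA].
have [i Ei] := hull_nth_ex tT (subset_trans sTA sAH).
by rewrite (bigcup_max i) // subsetI sTA Ei transv_hull.
Qed.

Lemma hull_nth_gen : <<\bigcup_i E i>> = H.
Proof.
apply/eqP; rewrite eqEsubset -{2}genH !gen_subG; apply/andP; split.
  by apply/bigcupsP=> i _; apply: hull_nth_sub.
apply/bigcupsP=> A /andP[bA sAH]; have [defA _] := best_gen bA.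
rewrite -defA genS //; apply/bigcupsP=> T; rewrite inE => /andP[tT sTA].
have [i Ei] := hull_nth_ex tT (subset_trans sTA sAH).
by rewrite (bigcup_max i) // Ei transv_hull.
Qed.

Lemma hull_nth_dprod : \big[dprod/1]_i E i = H.
Proof. exact: bigdprod_gen hull_nth_comm hull_nth_TI hull_nth_gen. Qed.

Lemma card_hulls_gt0 : H :!=: 1 -> 0 < #|hulls|.
Proof.
move=> ntH; rewrite lt0n; apply: contraNneq ntH => r0; rewrite -hull_nth_dprod.
rewrite big1 // => i; case: (i) => m ltm; exfalso; have := ltm.
by rewrite r0 ltn0.
Qed.

Lemma hull_nth_comm_sub i : [~: V, E i] \subset V.
Proof. by rewrite commg_subl (subset_trans (hull_nth_sub i)) // (subset_trans sHF). Qed.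

(** This is the coprime decomposition of V under the p'-group M. It contains the p'-part of every
    hull, so M and H have the same fixed points in V, and [V, M] is generated by the planes. *)
Lemma hull_nth_comm_dprod :
  'C_V(H) \x \big[dprod/1]_i [~: V, E i] = V.
Proof.
pose W := <<\bigcup_i [~: V, E i]>>%G.
have sWV : W \subset V.
  by rewrite gen_subG; apply/bigcupsP=> i _; apply: hull_nth_comm_sub.
have nVH : H \subset 'N(V) := subset_trans sHF nVF.
have defVE i : [~: V, E i] \x 'C_V(E i) = V.
  by have [T /andP[tT _] ->] := hull_nthP i; apply: hull_dprod.
have defW : \big[dprod/1]_i [~: V, E i] = W.
  apply: (bigdprod_gen (F := fun i => [~: V, E i]%G)) => [i j ne|i|//].
    by rewrite (sub_abelian_cent2 cVV) ?hull_nth_comm_sub.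
  have [_ _ _ tiE] := dprodP (defVE i); apply/trivgP; rewrite -tiE setIS //.
  rewrite gen_subG; apply/bigcupsP=> j ne.
  by rewrite subsetI hull_nth_comm_sub hull_nth_cent.
pose M := (N :&: H)%G; have sMH : M \subset H := subsetIr _ _.
have p'M : p^'.-group M := pgroupS (subsetIl _ _) p'N.
have nVM := subset_trans sMH nVH.
have coVM : coprime #|V| #|M| := pnat_coprime pV p'M.
have sWM : W \subset [~: V, M].
  rewrite gen_subG; apply/bigcupsP=> i _.
  have sEH := hull_nth_sub i; have [T /andP[tT _] defE] := hull_nthP i.
  by rewrite defE /= -(hull_comm_core tT) commgS // setIS // -defE.
have sMW : [~: V, M] \subset W.
  rewrite (subset_trans (commgS _ sMH)) // -hull_nth_gen commg_gen_sub //.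
  - exact: sub_abelian_norm cVV sWV.
  - apply/bigcupsP=> i _; rewrite -commg_subl (subset_trans (commSg _ sWV)) //.
    by rewrite sub_gen // (bigcup_max i).
  rewrite gen_subG; apply/subsetP=> _ /imset2P[v a Vv /bigcupP[i _ Ea] ->].
  by rewrite mem_gen //; apply/bigcupP; exists i; rewrite ?mem_commg.
have eqC : 'C_V(M) = 'C_V(H).
  apply/eqP; rewrite eqEsubset !subsetI !subsetIl /= -{2}hull_nth_gen.
  rewrite [X in _ && X](subset_trans (subsetIr _ _)) ?centS // andbT.
  rewrite cent_gen centsC; apply/bigcupsP=> i _; rewrite centsC.
  have sEH := hull_nth_sub i; have [T /andP[tT _] defE] := hull_nthP i.
  apply: subset_trans (subsetIr V _); rewrite defE -(cent_hull_core tT).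
  by rewrite setIS // centS // setIS // -defE.
rewrite defW dprodE.
- rewrite -[RHS](coprime_cent_mul_comm nVM coVM) ?abelian_sol // eqC.
  by congr (_ * _); apply/eqP; rewrite eqEsubset sWM.
- by rewrite (sub_abelian_cent2 cVV) ?subsetIl.
apply/trivgP; rewrite -(coprime_abel_cent_TI nVM coVM cVV) /= -eqC setIC.
by rewrite setIA (setIidPl sWV) setSI.
Qed.

Lemma hull_nth_SL2 i : [/\ #|[~: V, E i]| = (p ^ 2)%N, E i \isog SL2 p & p = 2 \/ p = 3].
Proof.
have [T /andP[tT _] ->] := hull_nthP i; have [iso p23] := hull_SL2 tT.
by split=> //; apply: (card_hull_comm tT).
Qed.

End Transvections.

(** * Best offenders for an external action *)

Section Glauberman.
Variables (aT gT : finGroupType) (D : {group aT}) (R : {group gT}).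
Variables (to : groupAction D R) (p : nat) (V : {group gT}) (F N H : {group aT}).
Hypotheses (p_pr : prime p) (abV : p.-abelem V) (sVR : V \subset R).
Hypotheses (sFD : F \subset D) (actsF : [acts F, on V | to]).
Hypotheses (faithF : [faithful F, on V | to]) (nsNF : N <| F).
Hypotheses (p'N : p^'.-group N) (solN : solvable N).
Hypothesis cNp : forall A : {group aT}, A \subset F -> p.-group A -> 'C_A(N) = 1.
Hypotheses (sHF : H \subset F) (nHN : N \subset 'N(H)).
Hypothesis genH : H \subset <<\bigcup_(A in best_offenders to p V H) A>>.
Implicit Type A B : {group aT}.

(** The injections into the semidirect product turn the action into conjugation, [act_commg] into a
    commutator subgroup and fixed points into centralisers. *)
Let f1 := sdpair1_morphism to.
Let f2 := sdpair2_morphism to.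
Let inj1 : 'injm f1 := injm_sdpair1 to.
Let inj2 : 'injm f2 := injm_sdpair2 to.
Let sHD : H \subset D := subset_trans sHF sFD.

Lemma act_commg_sdpair A : A \subset F ->
  f1 @* act_commg to V A = [~: f1 @* V, f2 @* A].
Proof.
move=> sAF; have sAD := subset_trans sAF sFD.
have toV v a : v \in V -> a \in A -> to v a \in V.
  by move=> Vv Aa; rewrite (acts_act actsF) // (subsetP sAF).
rewrite morphim_gen; last first.
  apply/subsetP=> _ /imset2P[v a Vv Aa ->].
  by rewrite groupM ?groupV ?(subsetP sVR) // toV.
congr <<_>>; apply/setP=> x; apply/morphimP/imset2P.
  case=> _ _ /imset2P[v a Vv Aa ->] ->; exists (f1 v) (f2 a).
  - by apply: (mem_morphim f1); rewrite ?(subsetP sVR).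
  - by apply: (mem_morphim f2); rewrite ?(subsetP sAD).
  have [Rv Da] := (subsetP sVR v Vv, subsetP sAD a Aa).
  rewrite morphM ?groupV ?morphV // ?(subsetP sVR) ?toV //.
  by rewrite [f1 (to v a)]sdpair_act // -commgEl.
case=> _ _ /morphimP[v Rv Vv ->] /morphimP[a Da Aa ->] ->.
exists (v^-1 * to v a); first by rewrite groupM ?groupV // (subsetP sVR) ?toV.
  by apply: imset2_f.
rewrite morphM ?groupV ?morphV // ?(subsetP sVR) ?toV //.
by rewrite [f1 (to v a)]sdpair_act // -commgEl.
Qed.

Lemma fix_sdpair A : A \subset D ->
  f1 @* 'Fix_(V | to)(A) = 'C_(f1 @* V)(f2 @* A).
Proof.
move=> sAD; rewrite -morphim_setIpre -gacentEsd gacentE //.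
by congr (f1 @* _); rewrite setIA (setIidPl sVR).
Qed.

Lemma card_fix_sdpair A : A \subset D ->
  #|'Fix_(V | to)(A)| = #|'C_(f1 @* V)(f2 @* A)|.
Proof.
by move=> sAD; rewrite -fix_sdpair // card_injm // subIset ?sVR.
Qed.

Let Vs := (f1 @* V)%G.
Let Fs := (f2 @* F)%G.
Let Ns := (f2 @* N)%G.
Let Hs := (f2 @* H)%G.

Let abVs : p.-abelem Vs. Proof. exact: morphim_abelem. Qed.
Let nVFs : Fs \subset 'N(Vs).
Proof. by rewrite /= -actsEsd. Qed.
Let cFVs : 'C_Fs(Vs) = 1.
Proof.
have := faithF; rewrite /faithful astabEsd // => /trivgP/(congr1 (fun X => f2 @* X)).
by rewrite morphim_setIpre morphim1.
Qed.
Let nsNFs : Ns <| Fs. Proof. exact: morphim_normal. Qed.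
Let p'Ns : p^'.-group Ns. Proof. exact: morphim_pgroup. Qed.
Let solNs : solvable Ns. Proof. exact: morphim_sol. Qed.
Let sNF : N \subset F := normal_sub nsNF.
Let preK (As : {group sdprod_by to}) : As \subset Fs -> f2 @* (f2 @*^-1 As) = As.
Proof. by move=> sAs; rewrite morphpreK // (subset_trans sAs) // morphimS. Qed.

Let cNps : forall As : {group sdprod_by to}, As \subset Fs -> p.-group As -> 'C_As(Ns) = 1.
Proof.
move=> As sAs pAs; have sAF : f2 @*^-1 As \subset F.
  by rewrite -(injmSK inj2) ?preK // subsetIl.
have pA : p.-group (f2 @*^-1 As) by rewrite /pgroup -(card_injm inj2) ?subsetIl // preK.
have sND := subset_trans sNF sFD.
rewrite -(preK sAs) /= -injm_subcent ?subsetIl //.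
by rewrite (cNp (A := (f2 @*^-1 As)%G)) ?morphim1.
Qed.
Let sHFs : Hs \subset Fs. Proof. exact: morphimS. Qed.
Let nHNs : Ns \subset 'N(Hs). Proof. exact: morphim_norms. Qed.

Lemma best_sdpair A : A \in best_offenders to p V H ->
  best p Vs Fs (f2 @* A) && (f2 @* A \subset Hs).
Proof.
rewrite !inE => /andP[/andP[sAH abA] /forallP leA].
have sAD := subset_trans sAH sHD; rewrite morphimS // andbT.
apply/bestP; split; first exact: morphim_abelem.
  by rewrite morphimS // (subset_trans sAH).
move=> Bs sBs; have sBA : f2 @*^-1 Bs \subset A.
  rewrite -(injmSK inj2) ?subsetIl // morphpreK ?(subset_trans sBs) //.
  exact: morphimS.
have := implyP (leA (f2 @*^-1 Bs)%G) sBA.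
rewrite !card_fix_sdpair ?subsetIl // -!(card_injm inj2) ?subsetIl //.
by rewrite /= morphpreK // (subset_trans sBs) // morphimS.
Qed.

Let genHs : <<\bigcup_(As : {group sdprod_by to} | best p Vs Fs As && (As \subset Hs)) As>> = Hs.
Proof.
apply/eqP; rewrite eqEsubset gen_subG; apply/andP; split.
  by apply/bigcupsP=> As /andP[].
rewrite sub_morphim_pre // (subset_trans genH) // gen_subG.
apply/bigcupsP=> A bA; rewrite -sub_morphim_pre; last first.
  by move: bA; rewrite !inE => /andP[/andP[sAH _] _]; apply: subset_trans sHD.
by rewrite sub_gen // (bigcup_max (f2 @* A)%G) ?best_sdpair.
Qed.

Theorem best_offenders_decomposition :
  exists r (E : 'I_r -> {group aT}),
  [/\ H :!=: 1 -> 0 < r /\ (p = 2 \/ p = 3),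
      forall i, E i \subset H,
      [/\ \big[dprod/1]_(i < r) E i = H,
          'Fix_(V | to)(H) \x \big[dprod/1]_(i < r) act_commg to V (E i) = V,
          forall i, [faithful E i, on act_commg to V (E i) | to] &
          forall i j, j != i -> E i \subset 'C(act_commg to V (E j) | to)],
      forall i, #|act_commg to V (E i)| = (p ^ 2)%N /\ E i \isog SL2 p &
      forall A : {group aT}, A \in best_offenders to p V H ->
        \big[dprod/1]_(i < r) (A :&: E i) = A /\
        (#|A| * #|'Fix_(V | to)(A)|)%N = #|V|].
Proof.
pose r := #|hulls p Vs Fs Ns Hs|.
pose Es := @hull_nth _ p Vs Fs Ns Hs.
pose g1 := invm_morphism inj1; pose g2 := invm_morphism inj2.
pose E (i : 'I_r) := (g2 @* Es i)%G; exists r, E.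
have sEsHs i : Es i \subset Hs by apply: hull_nth_sub.
have sEsD i : Es i \subset f2 @* D by rewrite (subset_trans (sEsHs i)) ?morphimS.
have EsE i : f2 @* E i = Es i by rewrite /= morphim_invmE morphpreK.
have sEH i : E i \subset H.
  by rewrite -(morphim_invm inj2 sHD) morphimS.
have sEF i : E i \subset F := subset_trans (sEH i) sHF.
have sED i : E i \subset D := subset_trans (sEF i) sFD.
have sUV i : act_commg to V (E i) \subset V.
  rewrite gen_subG; apply/subsetP=> _ /imset2P[v a Vv Ea ->].
  by rewrite groupM ?groupV // (acts_act actsF) // (subsetP (sEF i)).
have UsE i : f1 @* act_commg to V (E i) = [~: Vs, Es i].
  by rewrite act_commg_sdpair // EsE.
have injg1 : 'injm g1 := injm_invm inj1.
have injg2 : 'injm g2 := injm_invm inj2.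
have sl2 := hull_nth_SL2 p_pr abVs nVFs cFVs nsNFs p'Ns cNps (H := Hs).
have sUR i : act_commg to V (E i) \subset R := subset_trans (sUV i) sVR.
split.
- move=> ntH; have ntHs : Hs :!=: 1 by rewrite morphim_injm_eq1.
  have r0 : 0 < r by apply: card_hulls_gt0 => //.
  by split=> //; have [] := sl2 (Ordinal r0).
- by [].
- split.
  + rewrite -[RHS](morphim_invm inj2 sHD).
    apply: (@injm_bigdprod _ _ _ g2 _ _ _ Es Hs); rewrite ?injm_invm ?morphimS //.
    exact: hull_nth_dprod.
  + have sVsD : Vs \subset f1 @* R by rewrite morphimS.
    have dV : 'C_Vs(Hs) \x \big[dprod/1]_i [~: Vs, Es i] = Vs.
      exact: hull_nth_comm_dprod.
    have [[K W defK defW] _ _ _] := dprodP dV; rewrite defW in dV.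
    have sWV : W \subset Vs by case/dprod_normal2: dV => _ /andP[].
    have := injm_dprod sVsD injg1 dV.
    rewrite -(injm_bigdprod (subset_trans sWV sVsD) injg1 defW).
    rewrite /= -fix_sdpair // !morphim_invm ?subIset ?sVR //.
    rewrite (eq_bigr (fun i => gval (act_commg to V (E i)))) // => i _.
    by rewrite -UsE [LHS](morphim_invm inj1 (sUR i)).
  + move=> i; rewrite /faithful astabEsd // -(injmSK inj2) ?subIset ?sED ?subxx //.
    by rewrite morphim1 morphim_setIpre EsE UsE hull_nth_faithful.
  move=> i j ne; rewrite astabEsd // -sub_morphim_pre // EsE UsE.
  by rewrite centsC; apply: hull_nth_cent.
- move=> i; have [oU iso _] := sl2 i.
  split; first by rewrite -(card_injm inj1) // UsE.
  by apply: isog_trans iso; rewrite isog_sym sub_isog.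
move=> A bA; have /andP[bAs sAs] := best_sdpair bA.
have sAH : A \subset H by move: bA; rewrite !inE => /andP[/andP[]].
have sAD := subset_trans sAH sHD.
have [dA oA] : \big[dprod/1]_i (f2 @* A :&: Es i) = f2 @* A /\
    (#|f2 @* A| * #|'C_Vs(f2 @* A)| = #|Vs|)%N by apply: best_nth.
split; last by rewrite card_fix_sdpair // -(card_injm inj2) // oA card_injm.
have sfA : f2 @* A \subset f2 @* D := morphimS _ sAD.
have := @injm_bigdprod _ _ _ g2 _ _ _ (fun i => f2 @* A :&: Es i)%G _ sfA injg2 dA.
rewrite /= morphim_invm // => {2}<-; apply: eq_bigr => i _.
by rewrite injmI ?morphim_invm.
Qed.

End Glauberman.

(** * Subnormal simple subgroups *)

Section Subnormal.
Variable gT : finGroupType.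
Implicit Types (p : nat) (G H K N S : {group gT}).

Lemma subnormal_pcore p S K : S <|<| K -> p.-group S -> S \subset 'O_p(K).
Proof.
move: {2}#|K|.+1 (ltnSn #|K|) => n; elim: n => // n IH in K *.
move=> ltK sS pS; case: (subnormalEr sS) => [<-|[M [sM nsM pM]]].
  by rewrite pcore_pgroup_id.
apply: subset_trans (IH M _ sM pS) _.
  exact: leq_trans (proper_card pM) ltK.
by rewrite pcore_max ?pcore_pgroup // gFnormal_trans.
Qed.

Lemma exists_simple_subnormal K : K :!=: 1 ->
  exists2 S : {group gT}, S <|<| K & simple S.
Proof.
move=> ntK; pose P (S : {group gT}) := (S <|<| K) && (S :!=: 1).
have [S /mingroupP[/andP[sS ntS] minS] _] : {S : {group gT} | mingroup S P & S \subset K}.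
  by apply: mingroup_exists; rewrite /P subnormal_refl.
exists S => //; apply/simpleP; split=> // H nsH.
have [->|ntH] := eqVneq (gval H) 1; [by left | right].
apply: minS; last exact: normal_sub.
by rewrite /P ntH (subnormal_trans (normal_subnormal nsH)).
Qed.

(** Induction through a proper normal K containing S. If S centralises the intersection of N and K,
    which contains [N, S], then [N, S, S] = 1, and the three subgroup lemma applies to S =
    [S, S]. *)
Lemma simple_subnormal_dichotomy S N G : simple S -> ~~ abelian S ->
  S <|<| G -> N <| G -> S \subset N \/ S \subset 'C(N).
Proof.
move=> simS nabS; have [ntS minS] := simpleP _ simS.
have SS : [~: S, S] = S.
  have [S1|//] := minS [~: S, S]%G (der_normal 1 S).
  by case/negP: nabS; apply/commG1P.
move: {2}#|G|.+1 (ltnSn #|G|) => n; elim: n => // n IH in G N *.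
move=> ltG snS nsN; case: (subnormalEr snS) => [defG|[K [sK nsK pK]]].
  rewrite -defG in nsN; have [->|->] := minS N nsN; last by left.
  by right; apply: cents1.
have ltK := leq_trans (proper_card pK) ltG.
have sSK := subnormal_sub sK; have nsNK : N :&: K <| K.
  by rewrite setIC (normalGI (normal_sub nsK) nsN).
have [sSN|cSN] := IH K (N :&: K)%G ltK sK nsNK.
  by left; rewrite (subset_trans sSN) ?subsetIl.
right; have sNS : [~: N, S] \subset N :&: K.
  rewrite subsetI commg_subl (subset_trans (subset_trans sSK (normal_sub nsK))) ?normal_norm //.
  rewrite (subset_trans (commgS _ sSK)) // commg_subr.
  exact: subset_trans (normal_sub nsN) (normal_norm nsK).
have c1 : [~: N, S, S] = 1.
  by apply/commG1P; rewrite (subset_trans sNS) // centsC.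
rewrite -SS; apply/commG1P; apply: three_subgroup => //.
by rewrite [[~: S, N]]commGC.
Qed.

(** Only the simple components enter, not all quasisimple ones: the argument starts from a minimal
    nontrivial subnormal subgroup, which is simple. *)
Definition components G : {group gT} :=
  <<(\bigcup_(S : {group gT} | [&& S <|<| G, simple S & ~~ abelian S]) S)%g>>%G.

Arguments components : simpl never.

Lemma sub_components S G : S <|<| G -> simple S -> ~~ abelian S ->
  S \subset components G.
Proof.
by move=> sS simS nab; rewrite sub_gen // (bigcup_max S) // sS simS.
Qed.

Lemma components_sub G : components G \subset G.
Proof.
rewrite gen_subG; apply/bigcupsP=> S /and3P[sS _ _]; exact: subnormal_sub.
Qed.

Lemma simpleJ S x : simple S -> simple (S :^ x).
Proof.
case/simpleP=> ntS minS; apply/simpleP; split=> [|H].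
  by rewrite -cardG_gt1 cardJg cardG_gt1.
rewrite -{1}(conjsgKV x H) normalJ => nsH; case: (minS (H :^ x^-1)%G nsH) => /= E.
  by left; rewrite -(conjsgKV x H) E conjs1g.
by right; rewrite -(conjsgKV x H) E.
Qed.

Lemma subnormalJ S G x : S <|<| G -> S :^ x <|<| G :^ x.
Proof.
move=> sS; have := morphim_subnormal (conjgm_morphism [set: gT]%G x) sS.
by rewrite !morphim_conj !setTI.
Qed.

Lemma componentsJ G x : components (G :^ x) = (components G :^ x)%G.
Proof.
have sub H y : components H :^ y \subset components (H :^ y).
  rewrite /components /= -genJ -bigcupJ gen_subG; apply/bigcupsP=> S /and3P[sS simS nab].
  by apply: (@sub_components (S :^ y)%G); rewrite ?subnormalJ ?simpleJ //= abelianJ.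
apply/val_inj/eqP; rewrite eqEsubset sub andbT -sub_conjgV /=.
by have := sub (G :^ x)%G x^-1; congr (_ \subset _); congr (gval (components _)); apply/val_inj; rewrite /= conjsgK.
Qed.

End Subnormal.

(** * Vertex stabilisers *)

Section Graph.
Variables (T : finType) (e : rel T) (G : {group {perm T}}).
Hypotheses (e_sym : symmetric e) (e_conn : connected_graph e).
Hypotheses (G_aut : G \subset graph_aut e) (G_arc : arc_transitive e G).
Hypothesis G_semiprim : forall v : T, semiprimitive_on (local_action e G v) (nbhd e v).
Implicit Types (A B N Q X Z : {group {perm T}}) (u v w x y : T) (g h : {perm T}).

(** [vstab] and [vker] are [vertex_stab] and [vertex_kernel] with their group structure; the
    underlying sets are convertible. *)
Definition vstab v : {group {perm T}} := ('C_G[v | 'P])%G.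
Definition vker v : {group {perm T}} := ('C_(vstab v)(nbhd e v | 'P))%G.

Arguments vstab : simpl never.
Arguments vker : simpl never.

Lemma vstabP g v : reflect (g \in G /\ g v = v) (g \in vstab v).
Proof.
rewrite inE; apply: (iffP andP) => [] [Gg].
  by move/astab1P.
by move=> gv; split=> //; apply/astab1P.
Qed.

Lemma vkerP g v : reflect (g \in vstab v /\ forall w, e v w -> g w = w) (g \in vker v).
Proof.
apply: (iffP setIP) => [] [Gg].
  by move=> cg; split=> // w ew; apply: (astab_act cg); rewrite inE.
move=> fixg; split=> //; apply/astabP=> w; rewrite inE; apply: fixg.
Qed.

Lemma autE g u v : g \in G -> e (g u) (g v) = e u v.
Proof.
move/(subsetP G_aut); rewrite inE => /forallP/(_ u)/forallP/(_ v)/eqP //.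
Qed.

Lemma vstab_sub v : vstab v \subset G. Proof. exact: subsetIl. Qed.

Lemma vstab_acts v : vstab v \subset 'N(nbhd e v | 'P).
Proof.
apply/subsetP=> g /vstabP[Gg gv]; rewrite !inE /=; apply/subsetP=> w.
by rewrite !inE /= /aperm -{2}gv autE.
Qed.

Lemma vker_normal v : vker v <| vstab v.
Proof.
rewrite /normal subsetIl /=; apply: normsI; first exact: normG.
exact: subset_trans (vstab_acts v) (astab_norm _ _).
Qed.

Lemma vker_sub_stab v : vker v \subset vstab v. Proof. exact: subsetIl. Qed.

Lemma vker_stab v w : e v w -> vker v \subset vstab w.
Proof.
move=> evw; apply/subsetP=> g /vkerP[/vstabP[Gg _] fixg].
by apply/vstabP; split=> //; apply: fixg.
Qed.

Lemma vstabJ g v : g \in G -> vstab v :^ g = vstab (g v).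
Proof.
move=> Gg; apply/setP=> h; rewrite mem_conjg; apply/vstabP/vstabP=> [] [Gh hv].
  split; first by rewrite -(groupJr _ (groupVr Gg)).
  by have := permJ (h ^ g^-1) g v; rewrite hv conjgKV.
split; first by rewrite groupJr ?groupV.
by apply: (@perm_inj _ g); rewrite -permJ conjgKV.
Qed.

Lemma nbhdJ g v w : g \in G -> e (g v) w = e v (g^-1 w).
Proof. by move=> Gg; rewrite -(autE v _ Gg) permKV. Qed.

Lemma vkerJ g v : g \in G -> vker v :^ g = vker (g v).
Proof.
move=> Gg; apply/setP=> h; rewrite mem_conjg; apply/vkerP/vkerP=> [] [Gh fixh].
  split=> [|w]; first by rewrite -vstabJ // mem_conjg.
  rewrite nbhdJ // => /fixh E; have := permJ (h ^ g^-1) g (g^-1 w).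
  by rewrite conjgKV E permKV.
split=> [|w ew]; first by rewrite -mem_conjg vstabJ.
apply: (@perm_inj _ g); rewrite -permJ conjgKV fixh //.
by rewrite nbhdJ // permK.
Qed.

Lemma swap_edge x y : e x y -> exists g, [/\ g \in G, g x = y & g y = x].
Proof. by move=> exy; apply: G_arc; rewrite // e_sym. Qed.

(** Along a path from x every vertex is an image of x or y under the group generated by A and B.
    This group normalises Z, so Z fixes all these images. *)
Lemma fix_edge x y A B Z : e x y -> Z \subset vstab x -> Z \subset vstab y ->
  A \subset vstab x -> B \subset vstab y -> A \subset 'N(Z) -> B \subset 'N(Z) ->
  [transitive A, on nbhd e x | 'P] -> [transitive B, on nbhd e y | 'P] -> Z :=: 1.
Proof.
move=> exy sZx sZy sAx sBy nZA nZB trA trB; pose N := (A <*> B)%G.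
have eyx : e y x by rewrite e_sym.
have nZN : N \subset 'N(Z) by rewrite join_subG nZA.
have sNG : N \subset G.
  by rewrite join_subG (subset_trans sAx (vstab_sub _)) (subset_trans sBy (vstab_sub _)).
pose P v := exists2 n, n \in N & v = n x \/ v = n y.
have step u v : P u -> e u v -> P v.
  case=> n Nn defu euv; have Gn := subsetP sNG n Nn.
  case: defu euv => ->; rewrite nbhdJ // => ev.
    have : n^-1 v \in nbhd e x by rewrite inE.
    have yx : y \in nbhd e x by rewrite inE.
    rewrite -(atransP trA y yx) => /orbitP[a Aa /= E].
    exists (a * n); first by rewrite groupM // (subsetP (joing_subl A B)).
    by right; rewrite permM [a y]E permKV.
  have : n^-1 v \in nbhd e y by rewrite inE.
  have xy : x \in nbhd e y by rewrite inE.
  rewrite -(atransP trB x xy) => /orbitP[a Aa /= E].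
  exists (a * n); first by rewrite groupM // (subsetP (joing_subr A B)).
  by left; rewrite permM [a x]E permKV.
have allP v : P v.
  have /connectP[p] := e_conn x v.
  elim/last_ind: p v => [v _ ->|p z IH v]; first by exists 1; rewrite // perm1; left.
  rewrite rcons_path last_rcons => /andP[pp ez] ->.
  exact: step (IH _ pp erefl) ez.
apply/trivgP/subsetP=> z Zz; apply/set1P/permP=> v; rewrite perm1.
have [n Nn defv] := allP v.
have Zzn : z ^ n^-1 \in Z by rewrite memJ_norm // groupV (subsetP nZN).
have [/vstabP[_ zx] /vstabP[_ zy]] := (subsetP sZx _ Zzn, subsetP sZy _ Zzn).
by case: defv => ->; rewrite -{1}(conjgKV n z) permJ ?zx ?zy.
Qed.

Lemma restr_orbit v N w : N \subset vstab v -> w \in nbhd e v ->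
  orbit 'P (restr_perm (nbhd e v) @* N) w = orbit 'P N w.
Proof.
move=> sN nw; have sNN := subset_trans sN (vstab_acts v).
apply/setP=> z; apply/orbitP/orbitP=> [] [g Ng <-].
  case/morphimP: Ng => h Nh Hh ->; exists h => //.
  by rewrite /= /aperm restr_permE.
exists (restr_perm (nbhd e v) g); first by rewrite mem_morphim ?(subsetP sNN).
by rewrite /= /aperm restr_permE ?(subsetP sNN).
Qed.

Lemma restr_trans v N : N \subset vstab v ->
  [transitive restr_perm (nbhd e v) @* N, on nbhd e v | 'P] =
  [transitive N, on nbhd e v | 'P].
Proof.
move=> sN; apply/imsetP/imsetP=> [] [w nw E]; exists w => //.
  by rewrite -(restr_orbit sN nw).
by rewrite (restr_orbit sN nw).
Qed.

(** If N acted semiregularly, its elements fixing y would act trivially on all neighbours of x. *)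
Lemma normal_trans x y N : N <| vstab x -> e x y ->
  ~~ (N :&: vstab y \subset vker x) -> [transitive N, on nbhd e x | 'P].
Proof.
move=> nsN exy nsub; have [_ semi] := G_semiprim x; have sN := normal_sub nsN.
have sNN := subset_trans sN (vstab_acts x).
have [] := semi (restr_perm (nbhd e x) @* N)%G; first exact: morphim_normal.
  by rewrite /= restr_trans.
move/(_ y); rewrite inE => /(_ exy) C1; case/negP: nsub.
apply/subsetP=> g /setIP[Ng /vstabP[Gg gy]].
have Nxg := subsetP sNN g Ng.
apply/vkerP; split; first exact: subsetP sN g Ng.
have : restr_perm (nbhd e x) g \in 'C_(restr_perm (nbhd e x) @* N)[y | 'P].
  rewrite inE mem_morphim //=; apply/astab1P.
  by rewrite /= /aperm restr_permE // inE.
rewrite C1 => /set1P r1 w ew.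
have := @restr_permE _ (nbhd e x) g w Nxg; rewrite inE => /(_ ew).
by rewrite r1 perm1.
Qed.

Lemma vstab_trans x y : e x y -> [transitive vstab x, on nbhd e x | 'P].
Proof.
move=> exy; apply/imsetP; exists y; first by rewrite inE.
apply/setP=> w; apply/idP/orbitP => [|[g /vstabP[Gg gx] <-]]; rewrite inE.
  move=> exw; have [g [Gg gx gy]] := G_arc exy exw.
  by exists g => //; apply/vstabP.
by rewrite -{1}gx /= /aperm autE.
Qed.

Lemma trans_mul x y N : N \subset vstab x -> e x y ->
  [transitive N, on nbhd e x | 'P] -> (vstab x :&: vstab y) * N = vstab x.
Proof.
move=> sN exy trN; have ny : y \in nbhd e x by rewrite inE.
have trG := vstab_trans exy.
rewrite -[RHS](subgroup_transitiveP ny sN trG trN); congr (_ * _).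
apply/setP=> g; rewrite !inE; case: (g \in G) => //=.
Qed.

Lemma fix_stabs x y Z : e x y -> Z \subset vstab x -> Z \subset vstab y ->
  vstab x \subset 'N(Z) -> vstab y \subset 'N(Z) -> Z :=: 1.
Proof.
move=> exy sZx sZy nx ny; have eyx : e y x by rewrite e_sym.
exact: fix_edge exy sZx sZy (subxx _) (subxx _) nx ny (vstab_trans exy) (vstab_trans eyx).
Qed.

Lemma eker_normal x y : e x y -> vker x :&: vker y <| vker x.
Proof.
move=> exy; rewrite /normal subsetIl normsI ?normG //.
exact: subset_trans (vker_stab exy) (normal_norm (vker_normal y)).
Qed.

Lemma eker_sub x y : e x y -> vker x :&: vker y \subset vstab x :&: vstab y.
Proof. by move=> exy; rewrite setISS ?vker_sub_stab. Qed.

Lemma eker_norm x y : vstab x :&: vstab y \subset 'N(vker x :&: vker y).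
Proof.
apply: normsI; first exact: subset_trans (subsetIl _ _) (normal_norm (vker_normal x)).
exact: subset_trans (subsetIr _ _) (normal_norm (vker_normal y)).
Qed.

Lemma vkerJ_group g v : g \in G -> (vker v :^ g)%G = vker (g v).
Proof. by move=> Gg; apply/val_inj/vkerJ. Qed.

Section Core.
Variable r : nat.
(** The prime r is kept general: some r-core is first shown nontrivial, and only [eker_pgroup]
    identifies r with p. *)
Definition vcore v : {group {perm T}} := ('O_r(vker v))%G.

Arguments vcore : simpl never.

Lemma vcoreJ g v : g \in G -> vcore v :^ g = vcore (g v).
Proof. by move=> Gg; rewrite /vcore /= -vkerJ // pcoreJ. Qed.

Lemma vcore_pgroup v : r.-group (vcore v). Proof. exact: pcore_pgroup. Qed.

Lemma vcore_normal v : vcore v <| vstab v.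
Proof. by rewrite gFnormal_trans ?vker_normal. Qed.

Lemma vcore_ker v : vcore v \subset vker v. Proof. exact: pcore_sub. Qed.

Lemma card_vcore x y : e x y -> #|vcore x| = #|vcore y|.
Proof. by move=> /swap_edge[g [Gg <- _]]; rewrite -vcoreJ // cardJg. Qed.

Lemma sub_vcore x Z : r.-group Z -> Z \subset vker x -> vker x \subset 'N(Z) ->
  Z \subset vcore x.
Proof. by move=> rZ sZ nZ; rewrite pcore_max // /normal sZ. Qed.

Lemma vcore_stab x y : e x y -> vcore x \subset vstab y.
Proof. by move=> exy; apply: subset_trans (vcore_ker x) (vker_stab exy). Qed.

(** Otherwise [vcore x] lies in [vcore y]; the orders agree, so both are equal and normal in both
    stabilisers, hence trivial. *)
Lemma vcore_not_sub x y : e x y -> vcore x :!=: 1 -> ~~ (vcore x \subset vker y).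
Proof.
move=> exy; apply: contra => sQ; have eyx : e y x by rewrite e_sym.
have sQQ : vcore x \subset vcore y.
  rewrite sub_vcore ?vcore_pgroup //.
  exact: subset_trans (vker_stab eyx) (normal_norm (vcore_normal x)).
have eQ : vcore x :=: vcore y by apply/eqP; rewrite eqEcard sQQ (card_vcore exy) /=.
apply/eqP; apply: (fix_stabs exy).
- exact: normal_sub (vcore_normal x).
- exact: vcore_stab.
- exact: normal_norm (vcore_normal x).
by rewrite eQ normal_norm ?vcore_normal.
Qed.

Notation L := (Lx e G r).

Lemma LxE x y : L x y = <<(\bigcup_(g in vstab x) (vcore x * vcore y) :^ g)%g>>%G.
Proof. by []. Qed.

Lemma Lx_norm x y : vstab x \subset 'N(L x y).
Proof.
apply/subsetP=> a Sa; rewrite inE LxE /= -genJ -bigcupJ genS //.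
apply/bigcupsP=> g Sg; rewrite -conjsgM.
by apply: (bigcup_max (g * a)) => //; rewrite groupM.
Qed.

Lemma vcore_mul_sub_Lx x y : vcore x * vcore y \subset L x y.
Proof.
by rewrite LxE /= sub_gen // (bigcup_max 1) ?group1 // conjsg1.
Qed.

Lemma vcore_sub_Lx x y : vcore x \subset L x y.
Proof. exact: subset_trans (mulG_subl _ _) (vcore_mul_sub_Lx x y). Qed.

Lemma vcore_sub_Lxr x y : vcore y \subset L x y.
Proof. exact: subset_trans (mulG_subr _ _) (vcore_mul_sub_Lx x y). Qed.

Lemma Lx_sub x y : e x y -> L x y \subset vstab x.
Proof.
move=> exy; have eyx : e y x by rewrite e_sym.
rewrite LxE gen_subG; apply/bigcupsP=> g Sg.
rewrite -(conjGid Sg) conjSg mul_subG //; last exact: vcore_stab.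
exact: normal_sub (vcore_normal x).
Qed.

Lemma Lx_normal x y : e x y -> L x y <| vstab x.
Proof. by move=> exy; rewrite /normal Lx_sub ?Lx_norm. Qed.

Lemma Lx_trans x y : e x y -> vcore x :!=: 1 -> [transitive L x y, on nbhd e x | 'P].
Proof.
move=> exy ntQ; have eyx : e y x by rewrite e_sym.
have ntQy : vcore y :!=: 1 by rewrite -cardG_gt1 -(card_vcore exy) cardG_gt1.
apply: (normal_trans (Lx_normal exy) exy).
apply: contra (vcore_not_sub eyx ntQy); apply: subset_trans.
by rewrite subsetI vcore_sub_Lxr (normal_sub (vcore_normal y)).
Qed.

Lemma comm_vker_vcore x y : e x y -> [~: vker x, vcore y] \subset vcore x.
Proof.
move=> exy; have eyx : e y x by rewrite e_sym.
have s1 : [~: vker x, vcore y] \subset vker x :&: vcore y.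
  rewrite subsetI commg_subl commg_subr; apply/andP; split.
    exact: subset_trans (vcore_stab eyx) (normal_norm (vker_normal x)).
  exact: subset_trans (vker_stab exy) (normal_norm (vcore_normal y)).
apply: subset_trans s1 (sub_vcore (Z := (vker x :&: vcore y)%G) _ _ _).
- exact: pgroupS (subsetIr _ _) (vcore_pgroup y).
- exact: subsetIl.
rewrite normsI ?normG //.
exact: subset_trans (vker_stab exy) (normal_norm (vcore_normal y)).
Qed.

(** Used mainly in this form: a subgroup between [vcore x] and [vker x] is normalised by [L x y],
    and one that lies in [L x y] is normalised by [vker x]. *)
Lemma comm_vker_Lx x y : e x y -> [~: vker x, L x y] \subset vcore x.
Proof.
move=> exy; have eyx : e y x by rewrite e_sym.
have nQ := normal_norm (vcore_normal x).
have sBL : \bigcup_(g in vstab x) (vcore x * vcore y) :^ g \subset L x y.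
  exact: sub_gen.
rewrite LxE /=; apply: commg_gen_sub.
- exact: subset_trans (vker_sub_stab x) nQ.
- exact: subset_trans sBL (subset_trans (Lx_sub exy) nQ).
rewrite gen_subG; apply/subsetP=> _ /imset2P[a b Ka /bigcupP[g Sg] Bb ->].
rewrite mem_conjg in Bb; have nQg : g \in 'N(vcore x) by apply: (subsetP nQ).
have Kag : a ^ g^-1 \in vker x.
  by rewrite memJ_norm ?groupV // (subsetP (normal_norm (vker_normal x))).
rewrite -(memJ_norm _ (groupVr nQg)) conjRg.
case/mulsgP: Bb => q1 q2 Q1 Q2 ->; rewrite commgMJ groupM //.
  by rewrite (subsetP (comm_vker_vcore exy)) // mem_commg.
rewrite memJ_norm; last first.
  by rewrite (subsetP nQ) // (subsetP (vcore_stab eyx)).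
rewrite (subsetP (_ : [~: vker x, vcore x] \subset _)) ?mem_commg //.
by rewrite commg_subr (subset_trans (vker_sub_stab x)).
Qed.

(* L u v normalises M = K * vcore u, for K the edge kernel, because
   [vker u, L u v] <= vcore u; and the r'-elements of M are those of K. *)
Lemma eker_vcore_pgroup x y : e x y -> vcore x :!=: 1 -> r.-group (vker x :&: vker y).
Proof.
move=> exy ntQ; have eyx : e y x by rewrite e_sym.
have ntQy : vcore y :!=: 1 by rewrite -cardG_gt1 -(card_vcore exy) cardG_gt1.
pose W u v := <<([set g in vker u :&: vker v | r^'.-elt g])%g>>%G.
have nWL u v : e u v -> L u v \subset 'N(W u v).
  move=> euv; pose K := (vker u :&: vker v)%G; pose M := (K <*> vcore u)%G.
  have nKQ : vcore u \subset 'N(K).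
    apply: subset_trans (eker_norm u v); apply/subsetIP.
    by split; [apply: normal_sub (vcore_normal u) | apply: vcore_stab].
  have sMu : M \subset vker u by rewrite join_subG subsetIl vcore_ker.
  have nML : L u v \subset 'N(M).
    rewrite -commg_subl (subset_trans (commSg _ sMu)) //.
    exact: subset_trans (comm_vker_Lx euv) (joing_subr _ _).
  have -> : W u v = <<[set g in M | r^'.-elt g]>>%G.
    apply/val_inj; congr <<_>>; apply/setP=> g; apply/setIdP/setIdP=> [] [Mg r'g].
      by split=> //; apply: (subsetP (joing_subl K (vcore u))).
    have nKM : M \subset 'N(K) by rewrite join_subG normG.
    split=> //; apply: (coset_idr (subsetP nKM g Mg)).
    apply/eqP; rewrite -order_eq1; apply/eqP; apply: (@pnat_1 r).
      apply: (mem_p_elt (G := M / K)); last exact: mem_quotient.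
      by rewrite /= quotientYidl // quotient_pgroup ?vcore_pgroup.
    exact: morph_p_elt (subsetP nKM g Mg) r'g.
  apply: norms_gen; apply/subsetP=> a La; rewrite inE.
  apply/subsetP=> _ /imsetP[g /setIdP[Mg r'g] ->]; rewrite inE p_eltJ r'g andbT.
  by rewrite memJ_norm ?(subsetP nML).
have WC : W y x = W x y.
  apply/val_inj; congr <<_>>; apply/setP=> g.
  by apply/setIdP/setIdP=> [] [/setIP[? ?] ?]; split=> //; apply/setIP.
have W1 : W x y :=: 1.
  have sWK : W x y \subset vker x :&: vker y.
    by rewrite gen_subG; apply/subsetP=> g /setIdP[].
  apply: (fix_edge exy _ _ (Lx_sub exy) (Lx_sub eyx)); try exact: Lx_trans.
  - exact: subset_trans sWK (subset_trans (subsetIl _ _) (vker_sub_stab x)).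
  - exact: subset_trans sWK (subset_trans (subsetIr _ _) (vker_sub_stab y)).
  - exact: nWL.
  by rewrite -WC nWL.
apply/pgroupP=> q q_pr /(Cauchy q_pr)[g Kg og]; apply: contraT => nrq.
have : g \in W x y by rewrite mem_gen // inE Kg /p_elt og pnatE.
by rewrite W1 => /set1P g1; move: q_pr; rewrite -og g1 order1.
Qed.

End Core.

Lemma eker_normal_r x y : e x y -> vker x :&: vker y <| vker y.
Proof. by move=> exy; rewrite setIC eker_normal // e_sym. Qed.

(* A nonabelian simple S subnormal in the edge kernel is excluded as follows.  If
   each nonabelian simple subnormal subgroup of one vertex kernel lies in the
   other one, the two kernels have the same components, normal in both stabilisers.
   Otherwise the centralisers of both kernels are transitive and normalise the
   edge kernel. *)
Lemma exists_vcore_neq1 x y : e x y -> vker x :&: vker y != 1 ->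
  exists2 r, prime r & vcore r x :!=: 1.
Proof.
move=> exy ntK; have eyx : e y x by rewrite e_sym.
pose K := (vker x :&: vker y)%G.
have [S snSK simS] := exists_simple_subnormal (ntK : K :!=: 1).
have [ntS _] := simpleP _ simS.
have snSx : S <|<| vker x.
  exact: subnormal_trans snSK (normal_subnormal (eker_normal exy)).
have snSy : S <|<| vker y.
  exact: subnormal_trans snSK (normal_subnormal (eker_normal_r exy)).
have [abS|nabS] := boolP (abelian S).
  (* S has prime order and is subnormal in [vker x], so it lies in the corresponding core. *)
  exists #|S|; first exact: simple_sol_prime (abelian_sol abS) simS.
  apply: contraNneq ntS => Q1; rewrite -subG1 -Q1.
  by apply: subnormal_pcore snSx _; apply: pnat_id; apply: simple_sol_prime (abelian_sol abS) simS.
exfalso; pose P u v := [exists S : {group {perm T}},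
  [&& S <|<| vker u, simple S, ~~ abelian S & ~~ (S \subset vker v)]].
have notP u v : e u v -> S <|<| vker u -> ~~ P u v -> False.
  move=> euv snSu /existsPn nP; have evu : e v u by rewrite e_sym.
  have sub : components (vker u) \subset components (vker v).
    rewrite gen_subG; apply/bigcupsP=> R /and3P[snR simR nabR].
    apply: sub_components => //; have := nP R; rewrite snR simR nabR negbK /= => sRv.
    apply: subnormal_trans (normal_subnormal (eker_normal_r euv)).
    have sRK : R \subset vker u :&: vker v by rewrite subsetI (subnormal_sub snR).
    rewrite -[gval R](setIidPl sRK).
    exact: (setI_subnormal (K := (vker u :&: vker v)%G) (subsetIl _ _) snR).
  have eqC : components (vker u) :=: components (vker v).
    have oC : #|components (vker v)| = #|components (vker u)|.
      have [g [Gg <- _]] := swap_edge euv.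
      by rewrite -vkerJ_group // componentsJ; apply: cardJg.
    by apply/eqP; rewrite eqEcard sub oC leqnn.
  have nC w : vstab w \subset 'N(components (vker w)).
    apply/normsP=> g Sg; have /(congr1 (@gval _)) /= <- := componentsJ (vker w) g.
    congr (gval (components _)); apply/val_inj => /=.
    exact: (normsP (normal_norm (vker_normal w))).
  have C1 : components (vker u) :=: 1.
    apply: (fix_stabs euv) => //.
    - exact: subset_trans (components_sub _) (vker_sub_stab u).
    - exact: subset_trans (components_sub _) (vker_stab euv).
    by rewrite eqC.
  have := sub_components snSu simS nabS; rewrite C1 => /trivgP S1.
  by rewrite S1 eqxx in ntS.
have transP u v : e u v -> P u v -> [transitive 'C_(vstab v)(vker v), on nbhd e v | 'P].
  move=> euv /existsP[R /and4P[snR simR nabR nsR]]; have evu : e v u by rewrite e_sym.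
  have nsC : ('C_(vstab v)(vker v))%G <| vstab v.
    rewrite /normal subsetIl normsI ?normG ?norms_cent //.
    by rewrite (normal_norm (vker_normal v)).
  apply: (normal_trans nsC evu); apply: contra (nsR); apply: subset_trans.
  have sRu := subnormal_sub snR.
  have sRuv : R \subset vstab v := subset_trans sRu (vker_stab euv).
  apply/subsetIP; split; last exact: subset_trans sRu (vker_sub_stab u).
  apply/subsetIP; split; first by [].
  (* Both kernels are normal in the arc stabiliser, so R is subnormal there and must lie in [vker v]
     or centralise it. *)
  pose Guv := (vstab u :&: vstab v)%G.
  have nsu : vker u <| Guv.
    apply/andP; split; first by apply/subsetIP; rewrite vker_sub_stab vker_stab.
    exact: subset_trans (subsetIl _ _) (normal_norm (vker_normal u)).
  have nsv : vker v <| Guv.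
    apply/andP; split; first by apply/subsetIP; rewrite vker_sub_stab vker_stab.
    exact: subset_trans (subsetIr _ _) (normal_norm (vker_normal v)).
  have [sRv|//] := simple_subnormal_dichotomy simR nabR
      (subnormal_trans snR (normal_subnormal nsu)) nsv.
  by rewrite sRv in nsR.
have [Pxy|/(notP x y exy snSx)//] := boolP (P x y).
have [Pyx|/(notP y x eyx snSy)//] := boolP (P y x).
have nKC w : K \subset vker w -> ('C_(vstab w)(vker w))%G \subset 'N(K).
  by move=> sKw; rewrite cents_norm // subIset // centS ?orbT.
case/eqP: ntK; apply: (fix_edge (Z := K) exy _ _ _ _ _ _ (transP _ _ eyx Pyx) (transP _ _ exy Pxy)).
- exact: subset_trans (subsetIl _ _) (vker_sub_stab x).
- exact: subset_trans (subsetIr _ _) (vker_sub_stab y).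
- exact: subsetIl.
- exact: subsetIl.
- exact: nKC (subsetIl _ _).
exact: nKC (subsetIr _ _).
Qed.

Lemma eker_pgroup x y p : e x y -> prime p -> p %| #|vker x :&: vker y| ->
  p.-group (vker x :&: vker y) /\ vcore p x :!=: 1.
Proof.
move=> exy p_pr p_dv.
have ntK : vker x :&: vker y != 1.
  by apply: contraTneq p_dv => ->; rewrite cards1 gtnNdvd ?prime_gt1.
have [r r_pr ntQ] := exists_vcore_neq1 exy ntK.
have rK := eker_vcore_pgroup exy ntQ.
by have := pgroupP rK p p_pr p_dv; rewrite inE => /eqP->.
Qed.

End Graph.

Arguments vstab : simpl never.
Arguments vker : simpl never.
Arguments vcore : simpl never.
Arguments Lx : simpl never.

(** * The Thompson subgroup *)

Section Thompson.
Variables (gT : finGroupType) (p : nat).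
Implicit Types (A B D K L N P Q S V : {group gT}).

(** For a Sylow subgroup P containing A one has L = N P, so ['C_P(N)] is a normal p-subgroup of
    L. *)
Lemma pcore1_cent L N A : N <| L -> p^'.-group N -> p.-group (L / N) ->
  'O_p(L) = 1 -> A \subset L -> p.-group A -> 'C_A(N) = 1.
Proof.
move=> nsN p'N pLN O1 sAL pA; have nNL := normal_norm nsN.
have [P sylP sAP] := Sylow_superset sAL pA.
have [sPL pP _] := and3P sylP; have nNP := subset_trans sPL nNL.
have defL : N * P = L.
  apply/eqP; rewrite eqEsubset (mul_subG (normal_sub nsN) sPL) /= -quotientSK //.
  have := pHall_id (quotient_pHall nNP sylP) pLN.
  by move=> /= ->.
have nC : 'C_P(N) <| L.
  rewrite /normal subIset ?sPL //= -{1}defL mul_subG //.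
    by rewrite cents_norm // centsC subsetIr.
  by rewrite normsI ?normG // norms_cent.
apply/trivgP; rewrite -O1 (subset_trans (setSI _ sAP)) // pcore_max //.
exact: pgroupS (subsetIl _ _) pP.
Qed.

Lemma omega_center_Syl_norm L x : x \in 'N(L) -> x \in 'N(omega_center_Syl p L).
Proof.
move=> Nx; rewrite inE /= -genJ genS // -bigcupJ.
apply/bigcupsP=> S sylS; apply: (bigcup_max (S :^ x)%G).
  by rewrite inE /= -(normP Nx) pHallJ2; rewrite inE in sylS.
rewrite (_ : 'Z((S :^ x)%G) = 'Z(S) :^ x) ?OhmJ //.
by rewrite /center /= centJ conjIg.
Qed.

Lemma thompson_sub_sub S : thompson_sub p S \subset S.
Proof. by rewrite gen_subG; apply/bigcupsP=> A /setIdP[/pElemP[]]. Qed.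

Lemma thompson_subJ S x : thompson_sub p (S :^ x) :=: thompson_sub p S :^ x.
Proof.
have EJ (R : {group gT}) y B : B \in 'E_p(R) -> (B :^ y)%G \in 'E_p(R :^ y).
  by case/pElemP=> sB abB; apply/pElemP; rewrite conjSg abelemJ.
have sub (R : {group gT}) y : thompson_sub p R :^ y \subset thompson_sub p (R :^ y).
  rewrite /= -genJ -bigcupJ genS //; apply/bigcupsP=> A /setIdP[EA /forall_inP leA].
  apply: (bigcup_max (A :^ y)%G) => //; rewrite inE EJ //=.
  apply/forall_inP=> B EB; rewrite cardJg -(cardJg B y^-1).
  by apply: (leA (B :^ y^-1)%G); rewrite -(conjsgK y R) EJ.
apply/eqP; rewrite eqEsubset sub andbT -sub_conjgV.
by have := sub (S :^ x)%G x^-1; rewrite /= conjsgK.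
Qed.

Lemma max_abelem_exists S : exists A, A \in max_abelem p S.
Proof.
have E1 : 1%G \in 'E_p(S) by apply/pElemP; rewrite sub1G abelem1.
case: (arg_maxnP (fun A : {group gT} => #|A|) E1) => A EA maxA.
by exists A; rewrite inE [A \in _]EA; apply/forall_inP.
Qed.

Lemma thompson_sub_eq S Q : thompson_sub p S \subset Q -> Q \subset S ->
  thompson_sub p S :=: thompson_sub p Q.
Proof.
move=> sJQ sQS; suffices E : max_abelem p S = max_abelem p Q by rewrite /thompson_sub E.
have sE B : B \in 'E_p(Q) -> B \in 'E_p(S).
  by case/pElemP=> sB abB; apply/pElemP; rewrite (subset_trans sB).
have sM B : B \in max_abelem p S -> B \in 'E_p(Q).
  move=> mB; have /setIdP[/pElemP[_ abB] _] := mB; apply/pElemP; split=> //.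
  by apply: subset_trans sJQ; rewrite sub_gen // (bigcup_max B).
have [A0 mA0] := max_abelem_exists S.
apply/setP=> A; apply/idP/idP=> mA.
  have /setIdP[_ /forall_inP leA] := mA; rewrite inE sM //=.
  by apply/forall_inP=> B EB; apply/leA/sE.
have /setIdP[EA /forall_inP leA] := mA; rewrite inE sE //=.
have /setIdP[_ /forall_inP leA0] := mA0.
by apply/forall_inP=> B EB; apply: leq_trans (leA0 B EB) (leA _ (sM _ mA0)).
Qed.

Lemma thompson_sub_neq1 S : p.-group S -> S :!=: 1 -> thompson_sub p S :!=: 1.
Proof.
move=> pS ntS; have [p_pr p_dv _] := pgroup_pdiv pS ntS.
have [z Sz oz] := Cauchy p_pr p_dv; have [A mA] := max_abelem_exists S.
have /setIdP[_ /forall_inP leA] := mA.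
have sAJ : A \subset thompson_sub p S by rewrite sub_gen // (bigcup_max A).
rewrite -cardG_gt1 (leq_trans _ (subset_leq_card sAJ)) //.
have Ez : <[z]>%G \in 'E_p(S).
  apply/pElemP; rewrite cycle_subG; split=> //.
  by apply: prime_abelem; rewrite -?orderE ?oz.
by have := leA _ Ez; rewrite /= -orderE oz; apply: leq_trans; apply: prime_gt1.
Qed.

Lemma thompson_Syl_norm L x : x \in 'N(L) -> x \in 'N(thompson_Syl p L).
Proof.
move=> Nx; rewrite inE /= -genJ genS // -bigcupJ.
apply/bigcupsP=> S sylS; apply: (bigcup_max (S :^ x)%G).
  by rewrite inE /= -(normP Nx) pHallJ2; rewrite inE in sylS.
by have /= <- := thompson_subJ S x.
Qed.

Lemma thompson_Syl_sub L : thompson_Syl p L \subset L.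
Proof.
rewrite gen_subG; apply/bigcupsP=> S; rewrite inE => sylS.
exact: subset_trans (thompson_sub_sub S) (pHall_sub sylS).
Qed.

(** The product D of ['C_V(B)] and B is elementary abelian, so |D| <= |A|; its factors meet in the
    intersection of V and A, which lies in ['C_V(A)]. Subgroups B above ['C_A(V)] suffice for the
    quotient acting on V. *)
Lemma max_abelem_offender L V S A B : V <| L -> p.-abelem V ->
  S \in 'Syl_p(L) -> A \in max_abelem p S -> 'C_A(V) \subset B -> B \subset A ->
  #|B| * #|'C_V(B)| <= #|A| * #|'C_V(A)|.
Proof.
move=> nsV abV sylS /setIdP[/pElemP[sAS abA] /forall_inP leA] sCB sBA.
rewrite inE in sylS; have [sSL pS _] := and3P sylS.
have cVV := abelem_abelian abV; have cBB := abelem_abelian (abelemS sBA abA).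
have sVA : V :&: A \subset 'C_A(V).
  by rewrite subsetI subsetIr subIset // (subset_trans cVV) ?orbT.
have eqI : V :&: B = V :&: A.
  apply/eqP; rewrite eqEsubset setIS //= subsetI subsetIl.
  exact: subset_trans sVA sCB.
have sVB : V :&: B \subset 'C_V(B).
  by rewrite subsetI subsetIl (subset_trans (subsetIr _ _) cBB).
have cCB : B \subset 'C('C_V(B)) by rewrite centsC subsetIr.
pose D := ('C_V(B) <*> B)%G; have defD : D = 'C_V(B) * B :> {set gT}.
  by rewrite /= cent_joinEr.
have abD : p.-abelem D.
  have := cprodEY cCB; move/cprod_abelem => -> /=.
  by rewrite (abelemS (subsetIl _ _) abV) (abelemS sBA abA).
have leD : #|D| <= #|A|.
  have sDL : D \subset L.
    rewrite defD mul_subG ?(subset_trans (subset_trans sBA sAS)) //.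
    exact: subset_trans (subsetIl _ _) (normal_sub nsV).
  (* D need not lie in S, but a conjugate does, and only its order matters. *)
  have [x Lx sDS] := Sylow_subJ sylS sDL (abelem_pgroup abD).
  rewrite -(cardJg D x^-1); apply: (leA (D :^ x^-1)%G).
  by apply/pElemP; rewrite abelemJ sub_conjgV.
have iCB : 'C_V(B) :&: B = V :&: A.
  rewrite -eqI; apply/eqP; rewrite eqEsubset setSI ?subsetIl //= subsetI sVB.
  exact: subsetIr.
have := mul_cardG 'C_V(B)%G B; rewrite /= iCB mulnC => ->.
rewrite -defD leq_mul // subset_leq_card // subsetI subsetIl /=.
exact: subset_trans (subsetIr _ _) (abelem_abelian abA).
Qed.

(* Frattini argument on a Sylow subgroup of the preimage of the p-core. *)
Lemma pcore_quotient_omega L : 'O_p(L / 'C_L(omega_center_Syl p L)) = 1.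
Proof.
set V := omega_center_Syl p L; pose C := ('C_L(V))%G.
have nVL : L \subset 'N(V).
  by apply/subsetP=> x Lx; apply: omega_center_Syl_norm; apply: (subsetP (normG L)).
have nCL : L \subset 'N(C) by rewrite normsI ?normG ?norms_cent.
have nsC : C <| L by rewrite /normal subsetIl.
have [T /= defT sCT nsT] := inv_quotientN nsC (pcore_normal p (L / C)).
have [S sylS] := Sylow_exists p L; pose P := (S :&: T)%G.
have sylP : p.-Sylow(T) P := Hall_setI_normal nsT sylS.
have [sPT pP _] := and3P sylP.
have nCT : T \subset 'N(C) := subset_trans (normal_sub nsT) nCL.
have defT' : C * P = T.
  apply/eqP; rewrite eqEsubset (mul_subG sCT sPT) /= -quotientSK //.
  have pT : p.-group (T / C) by rewrite /= -defT pcore_pgroup.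
  have := pHall_id (quotient_pHall (subset_trans sPT nCT) sylP) pT.
  by move=> /= ->.
have defL : C * 'N_L(P) = L.
  rewrite -{2}(Frattini_arg nsT sylP) -defT' -mulgA; congr (_ * _).
  apply/esym/mulSGid; rewrite subsetI (subset_trans sPT (normal_sub nsT)).
  exact: normG.
have cVP : V \subset 'C(P).
  rewrite gen_subG; apply/bigcupsP=> S1; rewrite inE => sylS1.
  have [x Lx ->] := Sylow_trans sylS sylS1.
  (* Write x = c n: c fixes the centre part of S, which lies in V and centralises P, and n
     normalises P; so the centre part of S^x centralises P as well. *)
  have : x \in C * 'N_L(P) by rewrite defL.
  case/mulsgP=> c n /setIP[_ /centP cc] /setIP[_ /normP nPn] ->.
  have sZV : 'Ohm_1('Z(S)) \subset V.
    by rewrite sub_gen // (bigcup_max S) // inE.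
  have sZP : 'Ohm_1('Z(S)) \subset 'C(P).
    rewrite (subset_trans (Ohm_sub _ _)) // subIset // (centS _) ?orbT //.
    exact: subsetIl.
  rewrite (_ : 'Z(S :^ (c * n)) = 'Z(S) :^ (c * n)); last first.
    by rewrite /center centJ conjIg.
  have nCPn : 'C(P) :^ n = 'C(P) by rewrite -centJ nPn.
  have -> : 'Ohm_1('Z(S) :^ (c * n)) = ('Ohm_1('Z(S)) :^ c) :^ n.
    by rewrite -conjsgM; exact: (OhmJ 1 'Z(S)%G (c * n)).
  suff sZcP : 'Ohm_1('Z(S)) :^ c \subset 'C(P).
    have := sZcP; rewrite -(conjSg _ _ n) => /subset_trans -> //.
    by rewrite nCPn.
  apply: subset_trans sZP.
  apply/subsetP=> _ /imsetP[z Zz ->]; rewrite conjgE -(cc z) ?mulKg //.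
  exact: subsetP sZV z Zz.
have sPC : P \subset C.
  by rewrite subsetI (subset_trans sPT (normal_sub nsT)) centsC.
suff T1 : T / C = 1 by exact: etrans defT T1.
by rewrite -defT' quotientMidl; apply: quotientS1.
Qed.

End Thompson.

(** * The group Lx and its quotient *)

(** Modulo its p'-core the nilpotent R is a p-group, and the commutator of a nontrivial p-group with
    a p-group acting on it is proper. *)
Lemma nilpotent_comm_p'group (gT : finGroupType) (p : nat) (R X : {group gT}) :
  nilpotent R -> p.-group X -> X \subset 'N(R) -> [~: R, X] = R -> p^'.-group R.
Proof.
move=> nilR pX nRX RX; set B := 'O_p^'(R).
have nBX : X \subset 'N(B) by rewrite (subset_trans nRX) // gFnorm_trans.
have nBR : R \subset 'N(B) by apply: gFnorm.
have pRB : p.-group (R / B).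
  rewrite /pgroup card_quotient //.
  have /and3P[_ _] := nilpotent_pcore_Hall p^' nilR.
  by rewrite -/B; apply: sub_in_pnat => q _; rewrite inE /= negbK.
have [RB1|ntRB] := eqVneq (R / B) 1.
  by rewrite (pgroupS _ (pcore_pgroup p^' R)) // -quotient_sub1 // RB1.
have nRXB : X / B \subset 'N(R / B) by apply: quotient_norms.
have pY : p.-group ((R / B) <*> (X / B)).
  by rewrite /= norm_joinEr // pgroupM pRB quotient_pgroup.
have := nil_comm_properl (pgroup_nil pY) (joing_subl _ _) ntRB.
move/(_ (X / B)); rewrite subsetI joing_subr nRXB => /(_ isT).
by rewrite -quotientR // RX properxx.
Qed.

Section Local.
Variables (T : finType) (e : rel T) (G : {group {perm T}}).
Hypotheses (e_sym : symmetric e) (e_conn : connected_graph e).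
Hypotheses (G_aut : G \subset graph_aut e) (G_arc : arc_transitive e G).
Hypothesis G_semiprim : forall v : T, semiprimitive_on (local_action e G v) (nbhd e v).
Variables (x y : T) (p : nat) (exy : e x y) (p_pr : prime p).
Local Notation vstab := (vstab G).
Local Notation vker := (vker e G).
Local Notation vcore := (vcore e G p).
Hypothesis ntQ : vcore x :!=: 1.
Local Notation rho := (restr_perm (nbhd e x)).
Local Notation D := 'N(nbhd e x | 'P).

Let eyx : e y x. Proof. by rewrite e_sym. Qed.
Let sGD : vstab x \subset D. Proof. exact: vstab_acts. Qed.
Let sQy : vcore y \subset vstab x. Proof. exact: vcore_stab. Qed.
Let ntQy : vcore y :!=: 1.
Proof. by rewrite -cardG_gt1 -(card_vcore e_sym G_aut G_arc p exy) cardG_gt1. Qed.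
Let nsQy : ~~ (vcore y \subset vker x).
Proof. exact: vcore_not_sub. Qed.

Lemma ker_restr_vstab (A : {set {perm T}}) : A \subset vstab x -> A :&: 'ker rho = A :&: vker x.
Proof.
by move=> sA; rewrite ker_restr_perm -{1}(setIidPl sA) -setIA.
Qed.

Variable R : {group {perm T}}.
Hypotheses (nsR : R <| local_action e G x) (nilR : nilpotent R).
Hypothesis regR : regular_on R (nbhd e x).

Definition regR_pre : {group {perm T}} := (vstab x :&: rho @*^-1 R)%G.
Arguments regR_pre : simpl never.
Local Notation Rh := regR_pre.

Let sRP : R \subset rho @* vstab x := normal_sub nsR.

Lemma restr_regR_pre : rho @* Rh = R.
Proof. by rewrite morphim_setIpre; apply/setIidPr. Qed.

Lemma regR_pre_normal : Rh <| vstab x.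
Proof.
rewrite /normal subsetIl /= normsI ?normG //.
apply: subset_trans (morphpre_norm _ R).
by rewrite -sub_morphim_pre // normal_norm.
Qed.

Lemma regR_pre_trans : [transitive Rh, on nbhd e x | 'P].
Proof. by rewrite -(restr_trans G_aut) ?subsetIl // restr_regR_pre; case: regR. Qed.

Lemma regR_pre_mul : (vstab x :&: vstab y) * Rh = vstab x.
Proof.
by apply: (trans_mul G_aut G_arc (N := Rh)) => //; [apply: subsetIl | apply: regR_pre_trans].
Qed.

Lemma vker_sub_regR_pre : vker x \subset Rh.
Proof.
apply/subsetP=> k Kk; have Gk := subsetP (vker_sub_stab e G x) k Kk.
rewrite inE Gk mem_morphpre ?(subsetP sGD) //.
have : k \in vstab x :&: 'ker rho by rewrite ker_restr_vstab // inE Gk.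
by case/setIP=> _ /mker ->.
Qed.

(* For X the image of Q_y, [R, X] X is normal in the local group and X fixes y,
   so semiprimitivity makes [R, X] transitive, whence [R, X] = R. *)
Lemma regular_p'group : p^'.-group R.
Proof.
pose X := (rho @* vcore y)%G; pose M := [~: R, X]%G; pose W := (M <*> X)%G.
have pX : p.-group X by rewrite morphim_pgroup ?vcore_pgroup.
have sXP : X \subset rho @* vstab x by rewrite morphimS.
have nRX : X \subset 'N(R) := subset_trans sXP (normal_norm nsR).
have nMR : R \subset 'N(M) by apply: commg_norml.
have nMX : X \subset 'N(M) by apply: commg_normr.
have nWR : R \subset 'N(W).
  apply/subsetP=> r Rr; rewrite inE conjYg (normsP nMR) // join_subG joing_subl /=.
  apply/subsetP=> _ /imsetP[a Xa ->]; rewrite conjg_mulR groupM //.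
    by rewrite (subsetP (joing_subr M X)).
  by rewrite (subsetP (joing_subl M X)) // -[[~ _, _]]invgK invgR groupV mem_commg.
have nXPy : rho @* (vstab x :&: vstab y) \subset 'N(X).
  rewrite morphim_norms // (subset_trans (subsetIr _ _)) // normal_norm //.
  exact: vcore_normal G_aut p y.
(* The vertex stabiliser is the product of the arc stabiliser, which normalises [vcore y], and the
   preimage of R, whose image R normalises [R, X] X. *)
have nWP : rho @* vstab x \subset 'N(W).
  rewrite -regR_pre_mul morphimMl ?(subset_trans (subsetIl (vstab x) _) sGD) //.
  apply: mul_subG; last by rewrite restr_regR_pre.
  rewrite normsY // normsR // (subset_trans _ (normal_norm nsR)) //.
  by rewrite morphimS // subsetIl.
have sMR : M \subset R by rewrite commg_subl.
have nsW : W <| rho @* vstab x by rewrite /normal join_subG (subset_trans sMR sRP) sXP.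
have yN : y \in nbhd e x by rewrite inE.
have ntX : X :!=: 1.
  apply: contra nsQy => /eqP X1.
  have : vcore y \subset vstab x :&: 'ker rho.
    rewrite subsetI sQy andTb kerE -sub_morphim_pre ?(subset_trans sQy) //.
    by apply/trivgP; exact: X1.
  by rewrite ker_restr_vstab // => /subsetIP[].
have cXy : X \subset 'C[y | 'P].
  apply/subsetP=> _ /morphimP[q Dq Qq ->]; apply/astab1P.
  rewrite /= /aperm restr_permE //.
  by have /vstabP[] := subsetP (normal_sub (vcore_normal G_aut p y)) q Qq.
have trW : [transitive W, on nbhd e x | 'P].
  have [_ semi] := G_semiprim x; have [//|semW] := semi W nsW.
  case/eqP: ntX; apply/trivgP; rewrite -(semW y yN) subsetI joing_subr.
  exact: cXy.
have trM : [transitive M, on nbhd e x | 'P].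
  apply/(subgroup_transitiveP yN (joing_subl M X) trW); apply/eqP.
  have WE : W :=: X * M by rewrite [LHS]norm_joinEr // (normC nMX).
  rewrite eqEsubset mul_subG ?subsetIl ?joing_subl // andTb {1}WE mulSg //.
  by apply/subsetIP; split=> //; exact: joing_subr.
have [trR semR] := regR.
have defR : M :=: R.
  by rewrite -(subgroup_transitiveP yN sMR trR trM) semR // mul1g.
exact: nilpotent_comm_p'group nilR pX nRX defR.
Qed.

Variables L N S : {group {perm T}}.
Hypotheses (defL : L = Lx e G p x y) (defN : N = (L :&: Rh)%G).
Hypothesis defS : S = (vcore x <*> vcore y)%G.
Let NE : N :=: L :&: Rh. Proof. by rewrite defN. Qed.
Let SE : S :=: vcore x <*> vcore y. Proof. by rewrite defS. Qed.
Let nQG : vstab x \subset 'N(vcore x) := normal_norm (vcore_normal G_aut p x).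
Let sQL : vcore x \subset L. Proof. by rewrite defL vcore_sub_Lx. Qed.
Let sQyL : vcore y \subset L. Proof. by rewrite defL vcore_sub_Lxr. Qed.
Let sLG : L \subset vstab x. Proof. by rewrite defL Lx_sub. Qed.
Let sNL : N \subset L. Proof. by rewrite NE subsetIl. Qed.
Let sNG : N \subset vstab x := subset_trans sNL sLG.
Let sSL : S \subset L. Proof. by rewrite SE join_subG sQL. Qed.
Lemma Lx_regR_pre_normal : N <| L.
Proof.
rewrite /normal sNL NE normsI ?normG //.
exact: subset_trans sLG (normal_norm regR_pre_normal).
Qed.

(** The product of [Rh] and [vcore y] is normalised by [vstab x] and contains both cores, hence all
    of L; intersect with L. *)
Lemma Lx_regR_pre_mul : N * vcore y = L.
Proof.
rewrite NE group_modr //; apply/setIidPl.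
have nRhQ : vcore y \subset 'N(Rh) := subset_trans sQy (normal_norm regR_pre_normal).
rewrite -norm_joinEr // defL LxE gen_subG; apply/bigcupsP=> g Sg.
have nY : vstab x \subset 'N(Rh <*> vcore y).
  rewrite -{1}regR_pre_mul mul_subG //; last first.
    exact: subset_trans (joing_subl _ _) (normG _).
  apply: normsY; first exact: subset_trans (subsetIl _ _) (normal_norm regR_pre_normal).
  exact: subset_trans (subsetIr _ _) (normal_norm (vcore_normal G_aut p y)).
rewrite /= -[Rh <*> _](normsP nY g Sg) conjSg mul_subG ?joing_subr //.
by rewrite (subset_trans (vcore_ker e G p x)) // (subset_trans vker_sub_regR_pre) ?joing_subl.
Qed.

(** A Sylow p-subgroup P above [vcore x] satisfies [vker x, P] <= vcore x <= P, so it is normal in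
    [vker x] and lies in its p-core. *)
Lemma Lx_vker_p' : p^'.-nat #|L :&: vker x : vcore x|.
Proof.
pose Z := (L :&: vker x)%G.
have sQZ : vcore x \subset Z by rewrite subsetI sQL vcore_ker.
have [P sylP sQP] := Sylow_superset sQZ (vcore_pgroup e G p x).
have [sPZ pP p'P] := and3P sylP.
suffices <- : P :=: vcore x by [].
apply/eqP; rewrite eqEsubset sQP andbT.
have sPL : P \subset L := subset_trans sPZ (subsetIl _ _).
have sPK : P \subset vker x := subset_trans sPZ (subsetIr _ _).
apply: sub_vcore => //; rewrite -commg_subr (subset_trans _ sQP) //.
by rewrite (subset_trans (commgS _ sPL)) // defL; exact: comm_vker_Lx.
Qed.

Let eqZ : L :&: vker x = N :&: vker x.
Proof. by rewrite NE -setIA (setIidPr vker_sub_regR_pre). Qed.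

Let sQN : vcore x \subset N.
Proof.
by rewrite NE subsetI sQL (subset_trans (vcore_ker e G p x)) ?vker_sub_regR_pre.
Qed.

(** The index splits at the kernel on the neighbours: the upper part divides |R|, the lower one is
    [Lx_vker_p']. *)
Lemma index_vcore_p' : p^'.-nat #|N : vcore x|.
Proof.
have sQZ : vcore x \subset L :&: vker x by rewrite subsetI sQL vcore_ker.
have sZN : L :&: vker x \subset N by rewrite eqZ subsetIl.
have <- : (#|N : L :&: vker x| * #|L :&: vker x : vcore x|)%N = #|N : vcore x|.
  exact: Lagrange_index sZN sQZ.
rewrite pnatM Lx_vker_p' andbT eqZ.
rewrite -ker_restr_vstab // indexgI -(setIidPr (subset_trans sNG sGD)) -card_morphim.
apply: pnat_dvd regular_p'group; apply: cardSg; rewrite -[gval R]restr_regR_pre.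
by rewrite morphimS // NE subsetIr.
Qed.

Lemma joing_vcore_pgroup : p.-group S.
Proof.
by rewrite SE norm_joinEr ?(subset_trans sQy) // pgroupM !vcore_pgroup.
Qed.

Lemma joing_vcore_Sylow : p.-Sylow(L) S.
Proof.
rewrite /pHall sSL joing_vcore_pgroup andTb.
have defSN : S * N = L.
  apply/eqP; rewrite eqEsubset mul_subG // -{1}Lx_regR_pre_mul.
  rewrite (normC (subset_trans sSL (normal_norm Lx_regR_pre_normal))) mulgS // SE.
  exact: joing_subr.
rewrite -defSN indexMg -indexgI (pnat_dvd _ index_vcore_p') // indexgS //.
by rewrite subsetI sQN SE joing_subl.
Qed.

(** N has three soluble layers: a subgroup of the nilpotent R, an abelian section since L
    centralises its kernel modulo [vcore x], and the p-group [vcore x]. *)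
Lemma Lx_regR_pre_sol : solvable N.
Proof.
have sND : N \subset D := subset_trans sNG sGD.
pose Z := (L :&: vker x)%G.
have kZ : 'ker_N rho = Z by rewrite ker_restr_vstab // -eqZ.
have nsZ : Z <| N.
  rewrite /normal -[gval Z]kZ subsetIl normsI ?normG //.
  exact: subset_trans sND (ker_norm _).
rewrite (series_sol nsZ); apply/andP; split.
  have nsQZ : vcore x <| Z.
    apply/andP; split; first by apply/subsetIP; split=> //; exact: vcore_ker.
    exact: subset_trans (subset_trans (subsetIl _ _) sLG) nQG.
  rewrite (series_sol nsQZ) (nilpotent_sol (pgroup_nil (vcore_pgroup e G p x))).
  apply: abelian_sol; rewrite /abelian quotient_cents2 ?normal_norm //.
  apply: subset_trans (comm_vker_Lx e_sym G_aut p exy).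
  by rewrite -defL commgSS ?subsetIl ?subsetIr.
have := first_isog_loc (restr_perm_morphism (nbhd e x)) sND.
rewrite kZ => /isog_sol ->; apply: solvableS (nilpotent_sol nilR).
by rewrite -restr_regR_pre morphimS // NE subsetIr.
Qed.

End Local.

Section Quotient.
Variables (T : finType) (e : rel T) (G : {group {perm T}}).
Hypotheses (e_sym : symmetric e) (e_conn : connected_graph e).
Hypotheses (G_aut : G \subset graph_aut e) (G_arc : arc_transitive e G).
Hypothesis G_semiprim : forall v : T, semiprimitive_on (local_action e G v) (nbhd e v).
Variables (x y : T) (p : nat) (exy : e x y) (p_pr : prime p).
Local Notation vstab := (vstab G).
Local Notation vker := (vker e G).
Local Notation vcore := (vcore e G p).
Hypotheses (ntQ : vcore x :!=: 1) (pK : p.-group (vker x :&: vker y)).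
Hypothesis ntK : vker x :&: vker y != 1.

Lemma trans_conj (A : {group {perm T}}) u g : g \in G ->
  [transitive A, on nbhd e u | 'P] -> [transitive A :^ g, on nbhd e (g u) | 'P].
Proof.
move=> Gg /imsetP[w uw defO]; apply/imsetP; exists (g w).
  by rewrite inE (autE G_aut) //; rewrite inE in uw.
apply/setP=> z; apply/idP/imsetP=> [|[h /imsetP[a Aa ->] ->]].
  rewrite inE -{1}(permKV g z) (autE G_aut) // => uz.
  have : g^-1 z \in orbit 'P A w by rewrite -defO inE.
  case/imsetP=> a Aa E; exists (a ^ g); first by rewrite memJ_conjg.
  by rewrite /= /aperm permJ -[a w]/(aperm w a) -[aperm w a]E permKV.
have : 'P%act w a \in nbhd e u by rewrite defO; apply: mem_orbit.
by rewrite !inE /= /aperm permJ (autE G_aut).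
Qed.

(** The edge kernel, a normal p-subgroup of both vertex kernels, lies in both cores. If the
    centraliser of [vcore x] were transitive, it and its conjugate by a swap would centralise the
    edge kernel and force it to be 1. *)
Lemma cent_vcore_vker : 'C_(vstab x)(vcore x) :&: vstab y \subset vker x.
Proof.
apply: contraR ntK => nsX; pose X := ('C_(vstab x)(vcore x))%G.
have nQ := normal_norm (vcore_normal G_aut p x).
have nsXG : X <| vstab x.
  apply/andP; split; first exact: subsetIl.
  by rewrite normsI ?normG ?norms_cent.
have trX := normal_trans G_aut G_semiprim nsXG exy nsX.
have [g [Gg gx gy]] := swap_edge e_sym G_arc exy.
have trXg := trans_conj Gg trX; rewrite gx in trXg.
have sKx : vker x :&: vker y \subset vcore x.
  apply: sub_vcore; [exact: pK | exact: subsetIl |].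
  exact: normal_norm (eker_normal G_aut exy).
have sKy : vker x :&: vker y \subset vcore y.
  apply: sub_vcore; [exact: pK | exact: subsetIr |].
  exact: normal_norm (eker_normal_r e_sym G_aut exy).
apply/eqP; apply: (fix_edge e_sym e_conn G_aut (A := X) (B := (X :^ g)%G)
   (Z := (vker x :&: vker y)%G) exy) => //.
- exact: subset_trans (eker_sub G exy) (subsetIl _ _).
- exact: subset_trans (eker_sub G exy) (subsetIr _ _).
- exact: subsetIl.
- by rewrite -gx -vstabJ // conjSg; exact: subsetIl.
- apply: cents_norm; rewrite centsC (subset_trans sKx) // centsC.
  exact: subsetIr.
apply: cents_norm; rewrite centsC (subset_trans sKy) // centsC.
by rewrite -gx -(vcoreJ G_aut) // centJ conjSg; exact: subsetIr.
Qed.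

Variables L S : {group {perm T}}.
Hypotheses (defL : L = Lx e G p x y) (SE : S :=: vcore x <*> vcore y).
Hypothesis sylS : p.-Sylow(L) S.
Let V := omega_center_Syl p L.
Let C := ('C_L(V))%G.
Let pS : p.-group S := pHall_pgroup sylS.
Let sSL : S \subset L := pHall_sub sylS.
Let sQS : vcore x \subset S. Proof. by rewrite SE joing_subl. Qed.
Let ntS : S :!=: 1.
Proof. by apply: contra ntQ => /eqP S1; rewrite -subG1 -S1. Qed.
Let sLG : L \subset vstab x. Proof. by rewrite defL Lx_sub. Qed.
Let nLG : vstab x \subset 'N(L). Proof. by rewrite defL Lx_norm. Qed.
Let nQG : vstab x \subset 'N(vcore x) := normal_norm (vcore_normal G_aut p x).
Let sSy : S \subset vstab y.
Proof.
rewrite SE join_subG (vcore_stab G p exy).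
exact: normal_sub (vcore_normal G_aut p y).
Qed.

Lemma Sylow_vker : S :&: vker x \subset vcore x.
Proof.
apply: sub_vcore; [exact: pgroupS (subsetIl _ _) pS | exact: subsetIr |].
rewrite -commg_subr; apply: subset_trans (_ : vcore x \subset _); last first.
  by apply/subsetIP; split=> //; exact: vcore_ker.
rewrite (subset_trans (commgS _ (subset_trans (subsetIl _ _) sSL))) // defL.
exact: comm_vker_Lx.
Qed.

Lemma center_Sylow_sub : 'Z(S) \subset vcore x.
Proof.
have sZS := center_sub S.
apply: subset_trans Sylow_vker; apply/subsetIP; split=> //.
apply: subset_trans cent_vcore_vker; apply/subsetIP; split.
  apply/subsetIP; split; first exact: subset_trans sZS (subset_trans sSL sLG).
  by rewrite (subset_trans (subsetIr _ _)) // centS.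
exact: subset_trans sZS sSy.
Qed.

(** Z(S) lies in [vcore x], which all of L normalises, so conjugates of S give nothing outside.
    Hence V is elementary abelian and centralised by [vcore x]. *)
Lemma omega_center_sub : V \subset 'Ohm_1('Z(vcore x)).
Proof.
rewrite gen_subG; apply/bigcupsP=> S1; rewrite inE => sylS1.
have [l Ll ->] := Sylow_trans sylS sylS1.
have nQl : l \in 'N(vcore x) by rewrite (subsetP nQG) ?(subsetP sLG).
have ZJ : 'Z((S :^ l)%G) = 'Z(S) :^ l by rewrite /center conjIg centJ.
apply: OhmS; suff sZ : 'Z(S) :^ l \subset 'Z(vcore x) by rewrite -ZJ in sZ.
rewrite sub_conjg; have -> : 'Z(vcore x) :^ l^-1 = 'Z(vcore x).
  have nl : l^-1 \in 'N(vcore x) by rewrite groupV.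
  by rewrite {1}/center conjIg -centJ (normP nl).
apply/subsetIP; split; first exact: center_Sylow_sub.
by rewrite (subset_trans (subsetIr _ _)) // centS.
Qed.

Lemma omega_center_abelem : p.-abelem V.
Proof.
apply: abelemS omega_center_sub (Ohm1_abelem _ (center_abelian _)).
exact: pgroupS (center_sub _) (vcore_pgroup e G p x).
Qed.

Lemma vcore_sub_cent : vcore x \subset C.
Proof.
apply/subsetIP; split; first exact: subset_trans sQS sSL.
rewrite centsC (subset_trans omega_center_sub) //.
exact: subset_trans (Ohm_sub _ _) (subsetIr _ _).
Qed.

Lemma Sylow_swap : exists g, [/\ g \in G, g x = y, S :^ g = S & vstab x :^ g = vstab y].
Proof.
have [g [Gg gx gy]] := swap_edge e_sym G_arc exy; exists g; split=> //.
  by rewrite SE conjYg !(vcoreJ G_aut) // gx gy joingC.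
by rewrite vstabJ // gx.
Qed.

(* A transitive 'C_L(V) and its conjugate by a swap of x and y would both
   centralise 'Ohm_1('Z(S)). *)
Lemma cent_omega_vker : C :&: vstab y \subset vker x.
Proof.
apply: contraLR isT => nsC; apply/negP=> _.
have nVG : vstab x \subset 'N(V).
  apply/subsetP=> a Ga; apply: omega_center_Syl_norm; exact: (subsetP nLG).
have nsCG : C <| vstab x.
  apply/andP; split; first exact: subset_trans (subsetIl _ _) sLG.
  by rewrite normsI // norms_cent.
have trC := normal_trans G_aut G_semiprim nsCG exy nsC.
have [g [Gg gx Sg Gxg]] := Sylow_swap.
have trCg := trans_conj Gg trC; rewrite gx in trCg.
pose Z := 'Ohm_1('Z(S))%G.
have sZS : Z \subset S := subset_trans (Ohm_sub 1 'Z(S)) (center_sub S).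
have sZV : Z \subset V by rewrite sub_gen // (bigcup_max S) // inE.
have Zg : Z :^ g = Z.
  have ZSg : 'Z(S) :^ g = 'Z(S) by rewrite /center conjIg -centJ Sg.
  have := OhmJ 1 'Z(S) g; rewrite ZSg; exact: esym.
have cCZ : C \subset 'C(Z) := subset_trans (subsetIr _ _) (centS sZV).
have Z1 : Z :=: 1.
  apply: (fix_edge e_sym e_conn G_aut (A := C) (B := (C :^ g)%G) exy) => //.
  - exact: subset_trans sZS (subset_trans sSL sLG).
  - exact: subset_trans sZS sSy.
  - exact: normal_sub nsCG.
  - by rewrite -Gxg conjSg; exact: normal_sub nsCG.
  - exact: cents_norm.
  by apply: cents_norm; rewrite -Zg centJ conjSg.
case/eqP: ntS; apply: (trivg_center_pgroup pS); apply/eqP.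
by rewrite -Ohm1_eq1; apply/eqP.
Qed.

Lemma cent_omega_Sylow : C :&: S \subset vcore x.
Proof.
apply: subset_trans Sylow_vker; apply/subsetIP; split; first exact: subsetIr.
by apply: subset_trans cent_omega_vker; apply: setIS.
Qed.

(* Otherwise the Thompson subgroups of S and of vcore x coincide, and this group
   is normalised by vstab x and by a swap of x and y. *)
Lemma thompson_Syl_not_cent : ~~ (thompson_Syl p L \subset C).
Proof.
apply/negP=> sJC; have sJS := thompson_sub_sub p S.
have sJQ : thompson_sub p S \subset vcore x.
  apply: subset_trans cent_omega_Sylow; apply/subsetIP; split=> //.
  by apply: subset_trans sJC; rewrite sub_gen // (bigcup_max S) // inE.
have defJ := thompson_sub_eq sJQ sQS.
case/eqP: (thompson_sub_neq1 pS ntS).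
have [g [Gg gx Sg Gxg]] := Sylow_swap.
have nJx : vstab x \subset 'N(thompson_sub p S).
  apply/subsetP=> a Ga; rewrite defJ; apply/normP; rewrite -thompson_subJ.
  have na : a \in 'N(vcore x) by rewrite (subsetP nQG).
  by rewrite (normP na).
apply: (fix_stabs e_sym e_conn G_aut G_arc exy) => //.
- exact: subset_trans sJS (subset_trans sSL sLG).
- exact: subset_trans sJS sSy.
rewrite -Gxg; have <- : thompson_sub p S :^ g = thompson_sub p S.
  by rewrite -thompson_subJ Sg.
by rewrite normJ conjSg.
Qed.

End Quotient.

Section ThompsonQuotient.
Variables (gT : finGroupType) (p : nat) (L N Q : {group gT}).
Local Notation V := (omega_center_Syl p L).
Local Notation C := 'C_L(V).
Local Notation to := ('J %% 'C_L(V))%gact.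
Local Notation J := (thompson_Syl p L).
Hypotheses (p_pr : prime p) (abV : p.-abelem V) (nsN : N <| L) (pQ : p.-group Q).
Hypotheses (NQ : N * Q = L) (p'NC : p^'.-group (N / C)) (solN : solvable N).
Hypothesis nsJC : ~~ (J \subset C).

Let nsV : V <| L.
Proof.
apply/andP; split.
  rewrite gen_subG; apply/bigcupsP=> S; rewrite inE => /andP[sS _].
  exact: subset_trans (Ohm_sub _ _) (subset_trans (center_sub _) sS).
by apply/subsetP=> x Lx; apply: omega_center_Syl_norm; apply: (subsetP (normG L)).
Qed.
Let nCL : L \subset 'N(C).
Proof. by rewrite normsI ?normG ?norms_cent ?normal_norm. Qed.
Let cVC : C \subset 'C(V | 'J).
Proof. by rewrite astabJ subsetIr. Qed.
Let sJL : J \subset L := thompson_Syl_sub p L.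

Lemma fix_quotient (B : {group gT}) : B \subset L -> 'Fix_(V | to)(B / C) = 'C_V(B).
Proof.
by move=> sBL; rewrite afix_mod ?afixJ // setTI (subset_trans sBL).
Qed.

(** A subgroup of A / C lifts to a subgroup of A containing ['C_A(V)]; both sides of the inequality
    upstairs carry the same extra factor, the order of ['C_A(V)]. *)
Lemma max_abelem_best_offender (S A : {group gT}) : S \in 'Syl_p(L) ->
  A \in max_abelem p S -> (A / C)%G \in best_offenders to p V (J / C).
Proof.
move=> sylS maxA.
have [/pElemP[sAS abA] _] := setIdP maxA.
have sAL : A \subset L.
  by rewrite (subset_trans sAS) //; move: sylS; rewrite inE => /pHall_sub.
have sAJ : A \subset J.
  rewrite sub_gen //; apply: (bigcup_max S) => //.
  by rewrite sub_gen //; apply: (bigcup_max A).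
rewrite inE; apply/andP; split.
  by apply/pElemP; rewrite quotientS ?quotient_abelem.
apply/forallP=> B'; apply/implyP=> sB'A.
pose B := (A :&: coset C @*^-1 B')%G.
have sBA : B \subset A := subsetIl _ _.
have sBL : B \subset L := subset_trans sBA sAL.
have defB : B / C = B'.
  rewrite /quotient morphim_setIpre; exact/setIidPr.
have sCB : 'C_A(V) \subset B.
  have sCC : 'C_A(V) \subset C by apply: setSI.
  apply/subsetIP; split; first exact: subsetIl.
  apply: subset_trans sCC _; rewrite -{1}[C]ker_coset; exact: ker_sub_pre.
have cardC (D : {group gT}) : 'C_A(V) \subset D -> D \subset A ->
    (#|'C_A(V)| * #|D / C|)%N = #|D|.
  move=> sCD sDA; rewrite -(Lagrange sCD); congr (_ * _)%N.
  have sDL := subset_trans sDA sAL.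
  rewrite card_morphim (setIidPr (subset_trans sDL nCL)) ker_coset.
  rewrite -indexgI; congr #|_ : _|.
  apply/eqP; rewrite eqEsubset; apply/andP; split; apply/subsetIP; split.
  - exact: subset_trans (subsetIl _ _) sDA.
  - exact: subset_trans (subsetIr _ _) (subsetIr _ _).
  - exact: sCD.
  exact: setSI.
rewrite -[gval B']defB /= !fix_quotient // -(leq_pmul2l (cardG_gt0 'C_A(V)%G)).
rewrite !mulnA !cardC //.
exact: max_abelem_offender nsV abV sylS maxA sCB sBA.
exact: subsetIl.
Qed.

Lemma thompson_quotient_gen :
  J / C \subset <<\bigcup_(A in best_offenders to p V (J / C)) A>>.
Proof.
pose W := <<(\bigcup_(A in best_offenders to p V (J / C)) A)%g>>%G.
have nCJ := subset_trans sJL nCL.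
rewrite sub_quotient_pre // gen_subG; apply/bigcupsP=> S sylS.
rewrite gen_subG; apply/bigcupsP=> A maxA.
have sAL : A \subset L.
  have [/pElemP[sAS _] _] := setIdP maxA.
  by rewrite (subset_trans sAS) //; move: sylS; rewrite inE => /pHall_sub.
rewrite -sub_quotient_pre ?(subset_trans sAL) // sub_gen //.
by apply: (bigcup_max (A / C)%G) => //; apply: max_abelem_best_offender sylS maxA.
Qed.

Theorem thompson_quotient_decomposition :
  exists r (E : 'I_r -> {group coset_of C}),
  [/\ 0 < r /\ (p = 2 \/ p = 3),
      forall i, E i \subset J / C,
      [/\ \big[dprod/1]_(i < r) E i = J / C,
          'Fix_(V | to)(J / C) \x \big[dprod/1]_(i < r) act_commg to V (E i) = V,
          forall i, [faithful E i, on act_commg to V (E i) | to] &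
          forall i j, j != i -> E i \subset 'C(act_commg to V (E j) | to)],
      forall i, #|act_commg to V (E i)| = (p ^ 2)%N /\ E i \isog SL2 p &
      forall A : {group coset_of C}, A \in best_offenders to p V (J / C) ->
        \big[dprod/1]_(i < r) (A :&: E i) = A /\
        (#|A| * #|'Fix_(V | to)(A)|)%N = #|V|].
Proof.
have nsNC : N / C <| L / C := quotient_normal _ nsN.
have [|||||||||||r [E [ntH sEH dE oE bE]]] :=
  @best_offenders_decomposition _ _ _ _ to p V (L / C)%G (N / C)%G (J / C)%G p_pr abV.
- by rewrite /= gacentJ centsC subsetIr.
- by rewrite quotientS ?subsetT.
- by rewrite astabs_mod // astabsJ quotientS // normal_norm.
- by rewrite /faithful astab_mod // astabJ -quotientIG ?subsetIr ?trivg_quotient.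
- exact: nsNC.
- exact: p'NC.
- exact: quotient_sol.
- move=> A sA pA; apply: pcore1_cent nsNC p'NC _ (pcore_quotient_omega p L) sA pA.
  have nNL := normal_norm nsN.
  have nCN : N \subset 'N(C) := subset_trans (normal_sub nsN) nCL.
  have -> : (L / C)%G = (N / C * (Q / C))%g :> {set _} by rewrite /= -quotientMl ?NQ.
  by rewrite quotientMidl !quotient_pgroup.
- exact: quotientS.
- apply: subset_trans (quotientS _ (normal_sub nsN)) _; apply: quotient_norms.
  by apply/subsetP=> x Lx; apply: thompson_Syl_norm; apply: (subsetP (normG L)).
- exact: thompson_quotient_gen.
exists r, E; split=> //; apply: ntH.
apply: contra nsJC => /eqP JC1; rewrite -quotient_sub1 ?JC1 //.
exact: subset_trans sJL nCL.
Qed.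

End ThompsonQuotient.

Theorem theorem1p2 (T : finType) (e : rel T) (G : {group {perm T}})
    (e_sym : symmetric e) (e_irr : irreflexive e)
    (e_conn : connected_graph e)
    (G_aut : G \subset graph_aut e)
    (G_arc : arc_transitive e G)
    (G_semiprim : forall v : T,
       semiprimitive_on (local_action e G v) (nbhd e v))
    (G_nilp : forall v : T,
       has_regular_normal_nilpotent (local_action e G v) (nbhd e v))
    (x y : T) (exy : e x y) (Gxy1_neq1 : edge_kernel e G x y <> 1)
    (p : nat) (p_pr : prime p) (p_dv : p %| #|edge_kernel e G x y|) :
  let V := Vx e G p x y in
  let H := Hx e G p x y in
  let to := conjV e G p x y in
  (p.-group (edge_kernel e G x y) /\ (p = 2 \/ p = 3)) /\
  exists (r : nat) (E : 'I_r -> {group coset_of 'C_(Lx e G p x y)(V)}),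
  [/\ 0 < r,
      forall i, E i \subset H,
      [/\ \big[dprod/1]_(i < r) E i = H,
          'Fix_(V | to)(H) \x \big[dprod/1]_(i < r) act_commg to V (E i) = V,
          forall i, [faithful E i, on act_commg to V (E i) | to] &
          forall i j, j != i ->
            E i \subset 'C(act_commg to V (E j) | to)],
      forall i, #|act_commg to V (E i)| = (p ^ 2)%N /\ E i \isog SL2 p &
      forall A : {group coset_of 'C_(Lx e G p x y)(V)},
        A \in best_offenders to p V H ->
        \big[dprod/1]_(i < r) (A :&: E i) = A /\
        (#|A| * #|'Fix_(V | to)(A)|)%N = #|V|].
Proof.
move=> V H to.
have eK : edge_kernel e G x y = vker e G x :&: vker e G y by apply: edge_kernelE.
have ntK : vker e G x :&: vker e G y != 1 by rewrite -eK; apply/eqP.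
have [pK ntQ] : p.-group (vker e G x :&: vker e G y) /\ vcore e G p x :!=: 1.
  apply: (eker_pgroup e_sym e_conn G_aut G_arc G_semiprim exy p_pr).
  by have := p_dv; rewrite eK.
have [R [nsR nilR regR]] := G_nilp x.
pose L := Lx e G p x y; pose N := (L :&: regR_pre e G x R)%G.
pose S := (vcore e G p x <*> vcore e G p y)%G.
have sylS : p.-Sylow(L) S.
  exact: (joing_vcore_Sylow e_sym e_conn G_aut G_arc G_semiprim exy ntQ nsR nilR regR
    (erefl L) (erefl N) (erefl S)).
have nsN : N <| L by apply: (Lx_regR_pre_normal e_sym G_aut exy nsR (erefl L) (erefl N)).
have NQ : N * vcore e G p y = L.
  exact: (Lx_regR_pre_mul e_sym G_aut G_arc exy nsR regR (erefl L) (erefl N)).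
have solN : solvable N.
  exact: (Lx_regR_pre_sol e_sym G_aut exy nsR nilR (erefl L) (erefl N)).
have abV : p.-abelem V.
  exact: (omega_center_abelem e_sym e_conn G_aut G_arc G_semiprim exy pK ntK
    (erefl L) (erefl (gval S)) sylS).
have sQC : vcore e G p x \subset 'C_L(V).
  exact: (vcore_sub_cent e_sym e_conn G_aut G_arc G_semiprim exy pK ntK
    (erefl L) (erefl (gval S)) sylS).
have nsJC : ~~ (thompson_Syl p L \subset 'C_L(V)).
  exact: (thompson_Syl_not_cent e_sym e_conn G_aut G_arc G_semiprim exy ntQ
    (erefl L) (erefl (gval S)) sylS).
have p'NC : p^'.-group (N / 'C_L(V)).
  have p'NQ := index_vcore_p' e_sym e_conn G_aut G_arc G_semiprim exy ntQ nsR nilR regR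
    (erefl L) (erefl N).
  (* Since [vcore x] centralises V, the order of the image of N divides the p'-number |N : vcore
     x|. *)
  apply: pnat_dvd p'NQ; rewrite card_morphim ker_coset.
  have nCN : N \subset 'N('C_L(V)).
    apply: subset_trans (normal_sub nsN) _; rewrite normsI ?normG ?norms_cent //.
    exact: normal_norm (Vx_normal e G p x y).
  by rewrite (setIidPr nCN); apply: indexgS.
have [r [E [[r_gt0 p23] sEH dE oE bE]]] :=
  thompson_quotient_decomposition p_pr abV nsN (vcore_pgroup e G p y) NQ p'NC solN nsJC.
have HE : H = thompson_Syl p L / 'C_L(V) by apply: quotientMidr.
split; first by rewrite eK.
by exists r, E; rewrite HE; split.
Qed.
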